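(* Let $n\ge2$ and let $\tilde A=(\tilde A_{ij})_{1\le i,j\le n}$ be the matrix with entries in $U_q(n)$ $$\tilde A_{ij}=(q-q^{-1})^{-1}\Big\{\delta_{ij}-\sum_{k\le \min(i,j)}S^{-1}(\hat E_{ki})\,S(\hat E_{jk})\Big\}.$$ Regard $U_q(n-1)\subset U_q(n)$ as the subalgebra generated by $e_i,f_i$ ($1\le i\le n-2$) and $q^{\pm E_{ii}/2}$ ($1\le i\le n-1$). Then: (1) the submatrix formed by the first $n-1$ rows and columns of $\tilde A$ is the corresponding matrix $\tilde A_0$ of $U_q(n-1)$; (2) $\tilde A_{nn}$ commutes with $U_q(n-1)$; (3) the entries $\phi_i=\tilde A_{in}$, $1\le i<n$, form a dual vector operator of $U_q(n-1)$: for $1\le i,k\le n-1$, $q^{E_{ii}}\phi_k=q^{-\delta_{ik}}\phi_kq^{E_{ii}}$, and for $1\le i\le n-2$, $1\le k\le n-1$, $$e_i\phi_k-q^{-\frac12(\varepsilon_i-\varepsilon_{i+1},\varepsilon_k)}\phi_ke_i=-q^{-1}\delta_{ki}\phi_{i+1}q^{-h_i/2},\qquad f_i\phi_k-q^{-\frac12(\varepsilon_i-\varepsilon_{i+1},\varepsilon_k)}\phi_kf_i=-q\,\delta_{k\,i+1}\phi_iq^{-h_i/2};$$ (4) the entries $\psi_i=\tilde A_{ni}$, $1\le i<n$, form a vector operator of $U_q(n-1)$: for $1\le i,k\le n-1$, $q^{E_{ii}}\psi_k=q^{\delta_{ik}}\psi_kq^{E_{ii}}$, and for $1\le i\le n-2$,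 $1\le k\le n-1$, $$e_i\psi_k-q^{\frac12(\varepsilon_i-\varepsilon_{i+1},\varepsilon_k)}\psi_ke_i=\delta_{k\,i+1}\psi_iq^{-h_i/2},\qquad f_i\psi_k-q^{\frac12(\varepsilon_i-\varepsilon_{i+1},\varepsilon_k)}\psi_kf_i=\delta_{ki}\psi_{i+1}q^{-h_i/2}.$$
   Context: Fix real $q>0$, $q\ne1$. $U_q(n)=U_q[gl(n,\mathbb{C})]$ is the algebra generated by $e_i,f_i$ ($1\le i\le n-1$) and commuting invertible $q^{\pm E_{ii}/2}$ ($1\le i\le n$), with $h_i=E_{ii}-E_{i+1\,i+1}$ and relations $q^{E_{ii}/2}e_jq^{-E_{ii}/2}=q^{(\delta_{ij}-\delta_{i,j+1})/2}e_j$, $q^{E_{ii}/2}f_jq^{-E_{ii}/2}=q^{-(\delta_{ij}-\delta_{i,j+1})/2}f_j$, $[e_i,f_j]=\delta_{ij}\frac{q^{h_i}-q^{-h_i}}{q-q^{-1}}$, and the $q$-Serre relations $x_i^2x_j-(q+q^{-1})x_ix_jx_i+x_jx_i^2=0$ for $|i-j|=1$, $x_ix_j=x_jx_i$ for $|i-j|>1$ ($x=e$ or $x=f$). The antipode $S$ is the algebra anti-automorphism with $S(e_i)=-q^{-1}e_i$, $S(f_i)=-qf_i$, $S(q^{E_{ii}/2})=q^{-E_{ii}/2}$. Set $E_{i\,i+1}=e_i$, $E_{i+1\,i}=f_i$ and recursively $E_{ij}=E_{ik}E_{kj}-q^{-1}E_{kj}E_{ik}$ for $i<k<j$ or $i>k>j$.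 Put $\hat E_{ii}=q^{E_{ii}}$ and $\hat E_{ij}=(q-q^{-1})q^{\frac12(E_{ii}+E_{jj}-1)}E_{ij}$ for $i\ne j$. The form satisfies $(\varepsilon_i,\varepsilon_j)=\delta_{ij}$. The matrix $\tilde A_0$ of $U_q(n-1)$ is defined by the same formula as $\tilde A$ with $n$ replaced by $n-1$, using the generators of $U_q(n-1)$. *)

(* Defs.v *)
From HB Require Import structures.
From mathcomp Require Import all_boot all_order all_algebra.
From mathcomp Require Import generic_quotient complex.
From mathcomp Require Import boolp reals.
From mathcomp Require Import ring zify.

Set Implicit Arguments.
Unset Strict Implicit.
Unset Printing Implicit Defensive.

Import Order.TTheory GRing.Theory Num.Theory.
Local Open Scope ring_scope.
Local Open Scope complex_scope.
Local Open Scope quotient_scope.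

(* Indices start at 0: the index set {1, ..., n} is 'I_n and {1, ..., n-1},
   which labels e_i, f_i and h_i, is 'I_n.-1.  For i in the latter, lo i and
   hi i are i and i+1 seen in {1, ..., n}. *)
Definition lo n (i : 'I_n.-1) : 'I_n := widen_ord (leq_pred n) i.

Lemma hi_subproof n (i : 'I_n.-1) : (i.+1 < n)%N.
Proof. by case: n i => [|n] [i hi]. Qed.

Definition hi n (i : 'I_n.-1) : 'I_n := Ordinal (hi_subproof i).

Lemma last_subproof n : (1 < n)%N -> (n.-1 < n)%N.
Proof. by case: n. Qed.

Definition last_index n (hn : (1 < n)%N) : 'I_n := Ordinal (last_subproof hn).

Lemma lo_inj n : injective (@lo n).
Proof. by move=> i j /(congr1 val) /= ij; apply: val_inj. Qed.

Lemma lo_hi n (i : 'I_n.-2) : lo (hi i) = hi (lo i) :> 'I_n.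
Proof. exact: val_inj. Qed.

(* The pairing (eps_i - eps_(i+1), eps_k), where (eps_i, eps_j) is the
   Kronecker symbol. *)
Definition root_pairing n (i : 'I_n.-1) (k : 'I_n) : int :=
  (k == lo i)%:Z - (k == hi i)%:Z.

Section Scalars.
Context {R : realType}.
Variable q : R.

Definition qC : R[i] := q%:C.

(* qhalf z is q^(z/2), computed with the positive square root of q. *)
Definition qhalf (z : int) : R[i] := (Num.sqrt q)%:C ^ z.

End Scalars.

(* U_q(n) is the free unital associative C-algebra on the symbols e_i, f_i,
   q^(E_ii/2) and q^(-E_ii/2), whose elements are represented by the terms
   below, modulo the congruence generated by the defining relations. *)
Inductive generator (n : nat) : Type :=
| Ge of 'I_n.-1
| Gf of 'I_n.-1
| GK of 'I_n
| GKV of 'I_n.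

Section Terms.
Variables (C : comNzRingType) (X : Type).

Inductive term : Type :=
| Var of X
| Cst of C
| Add of term & term
| Mul of term & term.

Fixpoint eval (B : algType C) (g : X -> B) (t : term) : B :=
  match t with
  | Var x => g x
  | Cst c => c%:A
  | Add s t => eval g s + eval g t
  | Mul s t => eval g s * eval g t
  end.

Inductive congruence (rel : term -> term -> Prop) : term -> term -> Prop :=
| cg_rel s t : rel s t -> congruence rel s t
| cg_refl s : congruence rel s s
| cg_sym s t : congruence rel s t -> congruence rel t s
| cg_trans s t u :
    congruence rel s t -> congruence rel t u -> congruence rel s u
| cg_add s s' t t' : congruence rel s s' -> congruence rel t t' ->
    congruence rel (Add s t) (Add s' t')
| cg_mul s s' t t' : congruence rel s s' -> congruence rel t t' ->
    congruence rel (Mul s t) (Mul s' t')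
| cg_addA s t u : congruence rel (Add s (Add t u)) (Add (Add s t) u)
| cg_addC s t : congruence rel (Add s t) (Add t s)
| cg_add0 s : congruence rel (Add (Cst 0) s) s
| cg_addN s : congruence rel (Add (Mul (Cst (-1)) s) s) (Cst 0)
| cg_mulA s t u : congruence rel (Mul s (Mul t u)) (Mul (Mul s t) u)
| cg_mul1 s : congruence rel (Mul (Cst 1) s) s
| cg_mulDl s t u : congruence rel (Mul (Add s t) u) (Add (Mul s u) (Mul t u))
| cg_mulDr s t u : congruence rel (Mul s (Add t u)) (Add (Mul s t) (Mul s u))
| cg_cstD a b : congruence rel (Cst (a + b)) (Add (Cst a) (Cst b))
| cg_cstM a b : congruence rel (Cst (a * b)) (Mul (Cst a) (Cst b))
| cg_cstC a s : congruence rel (Mul (Cst a) s) (Mul s (Cst a)).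

Lemma eval_congruence rel (B : algType C) (g : X -> B) :
  (forall s t, rel s t -> eval g s = eval g t) ->
  forall s t, congruence rel s t -> eval g s = eval g t.
Proof.
move=> Hg s t; elim=> //=.
- by move=> s0 t0 u _ -> _ ->.
- by move=> s0 s' t0 t' _ -> _ ->.
- by move=> s0 s' t0 t' _ -> _ ->.
- by move=> *; rewrite addrA.
- by move=> *; rewrite addrC.
- by move=> *; rewrite scale0r add0r.
- by move=> s0; rewrite -scalerAl mul1r scaleN1r addNr scale0r.
- by move=> *; rewrite mulrA.
- by move=> *; rewrite scale1r mul1r.
- by move=> *; rewrite mulrDl.
- by move=> *; rewrite mulrDr.
- by move=> *; rewrite scalerDl.
- by move=> *; rewrite -scalerAl mul1r scalerA.
- by move=> *; rewrite -scalerAl -scalerAr mul1r mulr1.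
Qed.

End Terms.

Arguments Var {C X}.
Arguments Cst {C X}.

Declare Scope presentation_scope.
Delimit Scope presentation_scope with P.
Bind Scope presentation_scope with term.
Notation "s + t" := (Add s t) : presentation_scope.
Notation "s * t" := (Mul s t) : presentation_scope.
Notation "s - t" := (Add s (Mul (Cst (-1)) t)) : presentation_scope.
Notation "a *: t" := (Mul (Cst a) t) : presentation_scope.

Section Relations.
Context {R : realType}.
Variables (q : R) (n : nat).
Notation C := R[i].

Let e (i : 'I_n.-1) : term C (generator n) := Var (Ge i).
Let f (i : 'I_n.-1) : term C (generator n) := Var (Gf i).
Let K (a : 'I_n) : term C (generator n) := Var (GK a).
Let KV (a : 'I_n) : term C (generator n) := Var (GKV a).
(* q^(h_i/2) and q^(-h_i/2) *)
Let Kh i : term C (generator n) := (K (lo i) * KV (hi i))%P.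
Let KhV i : term C (generator n) := (KV (lo i) * K (hi i))%P.

Inductive Uq_rel : term C (generator n) -> term C (generator n) -> Prop :=
| rel_KKV a : Uq_rel (K a * KV a) (Cst 1)
| rel_KVK a : Uq_rel (KV a * K a) (Cst 1)
| rel_KK a b : Uq_rel (K a * K b) (K b * K a)
| rel_Ke a j : Uq_rel (K a * e j * KV a) (qhalf q (root_pairing j a) *: e j)
| rel_Kf a j : Uq_rel (K a * f j * KV a) (qhalf q (- root_pairing j a) *: f j)
| rel_ef i j : Uq_rel (e i * f j - f j * e i)
    (((i == j)%:R / (qC q - (qC q)^-1)) *: (Kh i * Kh i - KhV i * KhV i))
| rel_ee (i j : 'I_n.-1) : (1 < `|i - j|)%N -> Uq_rel (e i * e j) (e j * e i)
| rel_ff (i j : 'I_n.-1) : (1 < `|i - j|)%N -> Uq_rel (f i * f j) (f j * f i)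
| rel_eee (i j : 'I_n.-1) : `|i - j|%N = 1%N -> Uq_rel
    (e i * e i * e j - (qC q + (qC q)^-1) *: (e i * e j * e i) + e j * e i * e i)
    (Cst 0)
| rel_fff (i j : 'I_n.-1) : `|i - j|%N = 1%N -> Uq_rel
    (f i * f i * f j - (qC q + (qC q)^-1) *: (f i * f j * f i) + f j * f i * f i)
    (Cst 0).

End Relations.

Section Quotient.
Context {R : realType}.
Variables (q : R) (n : nat).
Notation C := R[i].
Notation tm := (term C (generator n)).
Notation cg := (congruence (@Uq_rel R q n)).

HB.instance Definition _ := gen_eqMixin tm.
HB.instance Definition _ := gen_choiceMixin tm.

Definition cgb (s t : tm) : bool := `[< cg s t >].

Lemma cgb_equiv : equiv_class_of cgb.
Proof.
split.
- by move=> s; apply/asboolP; apply: cg_refl.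
- by move=> s t; apply/asboolP/asboolP; apply: cg_sym.
- move=> t s u /asboolP H1 /asboolP H2; apply/asboolP.
  exact: cg_trans H1 H2.
Qed.

Canonical cgb_equivRel := EquivRelPack cgb_equiv.

Definition Uq : Type := {eq_quot cgb_equivRel}.

HB.instance Definition _ := Choice.on Uq.
HB.instance Definition _ := Quotient.on Uq.

Lemma Uq_eqP (s t : tm) : (\pi_Uq s = \pi_Uq t) <-> cg s t.
Proof.
split; first by move/eqmodP/asboolP.
by move=> H; apply/eqmodP/asboolP.
Qed.

Lemma Uq_repr (s : tm) : cg (repr (\pi_Uq s)) s.
Proof. by apply/Uq_eqP; rewrite reprK. Qed.

Definition uadd (x y : Uq) : Uq := \pi_Uq (Add (repr x) (repr y)).
Definition umul (x y : Uq) : Uq := \pi_Uq (Mul (repr x) (repr y)).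
Definition uopp (x : Uq) : Uq := umul (\pi_Uq (Cst (-1))) x.
Definition uscale (a : C) (x : Uq) : Uq := umul (\pi_Uq (Cst a)) x.

Lemma uaddE s t : uadd (\pi_Uq s) (\pi_Uq t) = \pi_Uq (Add s t).
Proof. by apply/Uq_eqP; apply: cg_add; apply: Uq_repr. Qed.

Lemma umulE s t : umul (\pi_Uq s) (\pi_Uq t) = \pi_Uq (Mul s t).
Proof. by apply/Uq_eqP; apply: cg_mul; apply: Uq_repr. Qed.

Lemma uaddA : associative uadd.
Proof.
elim/quotW=> s; elim/quotW=> t; elim/quotW=> u.
by rewrite (uaddE t u) (uaddE s t) !uaddE; apply/Uq_eqP; apply: cg_addA.
Qed.

Lemma uaddC : commutative uadd.
Proof.
by elim/quotW=> s; elim/quotW=> t; rewrite !uaddE; apply/Uq_eqP; apply: cg_addC.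
Qed.

Lemma uadd0 : left_id (\pi_Uq (Cst 0)) uadd.
Proof. by elim/quotW=> s; rewrite !uaddE; apply/Uq_eqP; apply: cg_add0. Qed.

Lemma uaddN : left_inverse (\pi_Uq (Cst 0)) uopp uadd.
Proof.
by elim/quotW=> s; rewrite /uopp (umulE _ s) uaddE; apply/Uq_eqP; apply: cg_addN.
Qed.

HB.instance Definition _ := GRing.isZmodule.Build Uq uaddA uaddC uadd0 uaddN.

Lemma umulA : associative umul.
Proof.
elim/quotW=> s; elim/quotW=> t; elim/quotW=> u.
by rewrite (umulE t u) (umulE s t) !umulE; apply/Uq_eqP; apply: cg_mulA.
Qed.

Lemma umul1 : left_id (\pi_Uq (Cst 1)) umul.
Proof. by elim/quotW=> s; rewrite !umulE; apply/Uq_eqP; apply: cg_mul1. Qed.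

Lemma umulr1 : right_id (\pi_Uq (Cst 1)) umul.
Proof.
elim/quotW=> s; rewrite !umulE; apply/Uq_eqP.
by apply: cg_trans (cg_mul1 _ _); apply: cg_sym; apply: cg_cstC.
Qed.

Lemma umulDl : left_distributive umul uadd.
Proof.
elim/quotW=> s; elim/quotW=> t; elim/quotW=> u.
rewrite (uaddE s t) (umulE s u) (umulE t u) umulE uaddE; apply/Uq_eqP.
exact: cg_mulDl.
Qed.

Lemma umulDr : right_distributive umul uadd.
Proof.
elim/quotW=> s; elim/quotW=> t; elim/quotW=> u.
rewrite (uaddE t u) (umulE s t) (umulE s u) umulE uaddE; apply/Uq_eqP.
exact: cg_mulDr.
Qed.

(* Nontriviality, witnessed by the character e_i, f_i |-> 0,
   q^(E_ii/2) |-> 1. *)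
Let counit (x : generator n) : C^o :=
  match x with Ge _ | Gf _ => 0 | GK _ | GKV _ => 1 end.

Lemma counit_rel s t : Uq_rel q s t -> eval counit s = eval counit t.
Proof.
case=> /= *; rewrite -?scalerAl ?scale1r ?scale0r ?mul1r ?mulr0 ?mul0r ?mulr1 //.
- by rewrite scaler0.
- by rewrite scaler0.
- by rewrite scaler0 add0r scaleN1r subrr scaler0.
- by rewrite !scaler0 !addr0.
- by rewrite !scaler0 !addr0.
Qed.

Lemma uone_neq0 : \pi_Uq (Cst 1) != \pi_Uq (Cst 0).
Proof.
apply/eqP=> /Uq_eqP /(eval_congruence counit_rel) /= /eqP.
by rewrite scale1r scale0r oner_eq0.
Qed.

HB.instance Definition _ := GRing.Zmodule_isNzRing.Build Uq
  umulA umul1 umulr1 umulDl umulDr uone_neq0.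

Lemma uscaleA a b x : uscale a (uscale b x) = uscale (a * b) x.
Proof.
rewrite /uscale umulA; congr (umul _ _); rewrite umulE.
by apply/Uq_eqP; apply: cg_sym; apply: cg_cstM.
Qed.

Lemma uscaleDr : right_distributive uscale +%R.
Proof. by move=> a x y; apply: umulDr. Qed.

Lemma uscaleDl x : {morph uscale^~ x : a b / a + b}.
Proof.
move=> a b; rewrite /uscale -[RHS]umulDl uaddE; congr (umul _ _).
apply/Uq_eqP; apply: cg_cstD.
Qed.

HB.instance Definition _ := GRing.Zmodule_isLmodule.Build C Uq
  uscaleA umul1 uscaleDr uscaleDl.

Lemma uscaleAl a (x y : Uq) : a *: (x * y) = (a *: x) * y.
Proof. exact: umulA. Qed.

HB.instance Definition _ := GRing.Lmodule_isLalgebra.Build C Uq uscaleAl.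

Lemma uscaleAr a (x y : Uq) : a *: (x * y) = x * (a *: y).
Proof.
have cst_central c z : umul (\pi_Uq (Cst c)) z = umul z (\pi_Uq (Cst c)).
  by elim/quotW: z => z; rewrite !umulE; apply/Uq_eqP; apply: cg_cstC.
rewrite [LHS]uscaleAl; rewrite /GRing.scale /= /uscale cst_central.
by rewrite -[LHS]umulA.
Qed.

HB.instance Definition _ := GRing.Lalgebra_isAlgebra.Build C Uq uscaleAr.

Definition e_ (i : 'I_n.-1) : Uq := \pi_Uq (Var (Ge i)).
Definition f_ (i : 'I_n.-1) : Uq := \pi_Uq (Var (Gf i)).
(* K_ a is q^(E_aa/2), so that q^(E_aa) is K_ a ^+ 2; KV_ a is q^(-E_aa/2);
   Kh_ i and KhV_ i are q^(h_i/2) and q^(-h_i/2). *)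
Definition K_ (a : 'I_n) : Uq := \pi_Uq (Var (GK a)).
Definition KV_ (a : 'I_n) : Uq := \pi_Uq (Var (GKV a)).
Definition Kh_ (i : 'I_n.-1) : Uq := K_ (lo i) * KV_ (hi i).
Definition KhV_ (i : 'I_n.-1) : Uq := KV_ (lo i) * K_ (hi i).

Definition Uq_gen (x : generator n) : Uq :=
  match x with
  | Ge i => e_ i | Gf i => f_ i | GK a => K_ a | GKV a => KV_ a
  end.

Lemma eval_Uq_gen t : eval Uq_gen t = \pi_Uq t.
Proof.
elim: t => [[]|c|s IHs t IHt|s IHs t IHt] //=.
- rewrite -[LHS]/(umul _ _) umulE; apply/Uq_eqP.
  by apply: cg_trans (cg_cstC _ _ _) _; apply: cg_mul1.
- by rewrite IHs IHt -uaddE.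
- by rewrite IHs IHt -umulE.
Qed.

Lemma Uq_gen_rel s t : Uq_rel q s t -> eval Uq_gen s = eval Uq_gen t.
Proof. by move=> st; rewrite !eval_Uq_gen; apply/Uq_eqP; apply: cg_rel. Qed.

Section Lift.
Variables (B : algType C) (g : generator n -> B).
Hypothesis Hg : forall s t, Uq_rel q s t -> eval g s = eval g t.

Definition Uq_lift (_ : forall s t, Uq_rel q s t -> eval g s = eval g t)
  (x : Uq) : B := eval g (repr x).

Let lift := Uq_lift Hg.

Lemma Uq_lift_pi t : lift (\pi_Uq t) = eval g t.
Proof. exact: eval_congruence Hg _ _ (Uq_repr t). Qed.

Lemma Uq_lift_gen x : lift (Uq_gen x) = g x.
Proof. by case: x => i; rewrite Uq_lift_pi. Qed.

Lemma liftB : zmod_morphism lift.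
Proof.
elim/quotW=> s; elim/quotW=> t.
have -> : \pi_Uq s - \pi_Uq t = \pi_Uq (s - t)%P.
  by rewrite -uaddE -umulE.
by rewrite !Uq_lift_pi /= -scalerAl mul1r scaleN1r.
Qed.

HB.instance Definition _ := GRing.isZmodMorphism.Build Uq B (Uq_lift Hg) liftB.

Lemma liftM : monoid_morphism lift.
Proof.
split; first by rewrite -[1]/(\pi_Uq (Cst 1)) Uq_lift_pi /= scale1r.
elim/quotW=> s; elim/quotW=> t.
by rewrite -[_ * _]/(umul _ _) umulE !Uq_lift_pi.
Qed.

HB.instance Definition _ := GRing.isMonoidMorphism.Build Uq B (Uq_lift Hg) liftM.

Lemma liftZ : scalable lift.
Proof.
move=> a; elim/quotW=> s.
by rewrite -[_ *: _]/(umul _ _) umulE !Uq_lift_pi /= -scalerAl mul1r.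
Qed.

HB.instance Definition _ := GRing.isScalable.Build C Uq B *:%R (Uq_lift Hg) liftZ.

End Lift.

Lemma Uq_ind (P : Uq -> Prop) :
  (forall i, P (e_ i)) -> (forall i, P (f_ i)) ->
  (forall a, P (K_ a)) -> (forall a, P (KV_ a)) ->
  (forall c, P c%:A) ->
  (forall x y, P x -> P y -> P (x + y)) ->
  (forall x y, P x -> P y -> P (x * y)) -> forall x, P x.
Proof.
move=> Pe Pf PK PKV P1 PD PM; elim/quotW=> t; rewrite -eval_Uq_gen.
by elim: t => [[]|c|s IHs t IHt|s IHs t IHt] //=; auto.
Qed.

End Quotient.

Section DefiningRelations.
Context {R : realType}.
Variables (q : R) (n : nat).
Implicit Types (i j : 'I_n.-1) (a b : 'I_n).
Notation e_ := (e_ q (n := n)).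
Notation f_ := (f_ q (n := n)).
Notation K_ := (K_ q (n := n)).
Notation KV_ := (KV_ q (n := n)).
Notation Kh_ := (Kh_ q (n := n)).
Notation KhV_ := (KhV_ q (n := n)).

Let rel := (@Uq_gen_rel R q n).

Lemma K_KV a : K_ a * KV_ a = 1.
Proof. by have := rel (rel_KKV q a); rewrite /= scale1r. Qed.

Lemma KV_K a : KV_ a * K_ a = 1.
Proof. by have := rel (rel_KVK q a); rewrite /= scale1r. Qed.

Lemma K_K a b : K_ a * K_ b = K_ b * K_ a.
Proof. exact: rel (rel_KK q a b). Qed.

Lemma K_KVC a b : K_ a * KV_ b = KV_ b * K_ a.
Proof.
rewrite -[LHS]mul1r -(KV_K b) -!mulrA; congr (_ * _).
by rewrite !mulrA K_K -!mulrA K_KV mulr1.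
Qed.

Lemma KV_KV a b : KV_ a * KV_ b = KV_ b * KV_ a.
Proof.
rewrite -[LHS]mul1r -(KV_K b) -!mulrA; congr (_ * _).
by rewrite !mulrA K_KVC -!mulrA K_KV mulr1.
Qed.

Lemma K_e a j : K_ a * e_ j * KV_ a = qhalf q (root_pairing j a) *: e_ j.
Proof. by have := rel (rel_Ke q a j); rewrite /= -scalerAl mul1r. Qed.

Lemma K_f a j : K_ a * f_ j * KV_ a = qhalf q (- root_pairing j a) *: f_ j.
Proof. by have := rel (rel_Kf q a j); rewrite /= -scalerAl mul1r. Qed.

Lemma e_f i j : e_ i * f_ j - f_ j * e_ i =
  ((i == j)%:R / (qC q - (qC q)^-1)) *: (Kh_ i ^+ 2 - KhV_ i ^+ 2).
Proof.
by have := rel (rel_ef q i j); rewrite /= -!scalerAl !mul1r !scaleN1r !expr2.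
Qed.

Lemma e_e i j : (1 < `|i - j|)%N -> e_ i * e_ j = e_ j * e_ i.
Proof. by move=> ij; apply: rel (rel_ee q ij). Qed.

Lemma f_f i j : (1 < `|i - j|)%N -> f_ i * f_ j = f_ j * f_ i.
Proof. by move=> ij; apply: rel (rel_ff q ij). Qed.

Lemma e_serre i j : `|i - j|%N = 1%N ->
  e_ i ^+ 2 * e_ j - (qC q + (qC q)^-1) *: (e_ i * e_ j * e_ i)
    + e_ j * e_ i ^+ 2 = 0.
Proof.
move=> ij; have := rel (rel_eee q ij); rewrite /= -!scalerAl !mul1r scaleN1r.
by rewrite scale0r expr2 !mulrA.
Qed.

Lemma f_serre i j : `|i - j|%N = 1%N ->
  f_ i ^+ 2 * f_ j - (qC q + (qC q)^-1) *: (f_ i * f_ j * f_ i)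
    + f_ j * f_ i ^+ 2 = 0.
Proof.
move=> ij; have := rel (rel_fff q ij); rewrite /= -!scalerAl !mul1r scaleN1r.
by rewrite scale0r expr2 !mulrA.
Qed.

End DefiningRelations.

(* The opposite algebra: algebra morphisms into it are anti-morphisms. *)
Section Opposite.
Variables (C : comNzRingType) (B : algType C).

Definition opposite : Type := GRing.converse B.

HB.instance Definition _ := GRing.NzRing.on opposite.
HB.instance Definition _ := GRing.Nmodule_isLSemiModule.Build C opposite
  (@scalerA C B) (@scale0r C B) (@scale1r C B) (@scalerDr C B)
  (fun v a b => @scalerDl C B v a b).

Lemma opposite_scalerAl (a : C) (x y : opposite) : a *: (x * y) = (a *: x) * y.
Proof. exact: (@scalerAr C B a y x). Qed.

HB.instance Definition _ :=
  GRing.LSemiModule_isLSemiAlgebra.Build C opposite opposite_scalerAl.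

Lemma opposite_scalerAr (a : C) (x y : opposite) : a *: (x * y) = x * (a *: y).
Proof. exact: (@scalerAl C B a y x). Qed.

HB.instance Definition _ :=
  GRing.Lalgebra_isAlgebra.Build C opposite opposite_scalerAr.

End Opposite.

Section Antipode.
Context {R : realType}.
Variables (q : R) (n : nat).
Notation U := (Uq q n).
Notation C := R[i].

Definition anti_gen (a b : C) (x : generator n) : opposite U :=
  match x with
  | Ge i => a *: e_ q i | Gf i => b *: f_ q i
  | GK k => KV_ q k | GKV k => K_ q k
  end.

Lemma opmulE (x y : opposite U) : x * y = (y : U) * (x : U) :> U.
Proof. by []. Qed.

Lemma anti_gen_rel (a b : C) :
  a * b = 1 \/ q = 0 -> forall s t, Uq_rel q s t ->
  eval (anti_gen a b) s = eval (anti_gen a b) t.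
Proof.
move=> ab s t; case=> {s t} /= => [k|k|k l|k j|k j|i j|i j ij|i j ij|i j ij|i j ij].
- by rewrite opmulE K_KV scale1r.
- by rewrite opmulE KV_K scale1r.
- by rewrite !opmulE KV_KV.
- rewrite -scalerAl mul1r !opmulE scalerA mulrC -scalerA -K_e.
  by rewrite -scalerAl -scalerAr mulrA.
- rewrite -scalerAl mul1r !opmulE scalerA mulrC -scalerA -K_f.
  by rewrite -scalerAl -scalerAr mulrA.
- rewrite !mulr_algl !opmulE scaleN1r -!scalerAl -!scalerAr !scalerA (mulrC b a).
  rewrite -scalerBr -opprB scalerN -scaleNr.
  rewrite e_f; case: ab => [->|q0]; last first.
    have -> : qC q - (qC q)^-1 = 0 by rewrite /qC q0 invr0 subr0.
    by rewrite invr0 mulr0 !scale0r scaler0.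
  rewrite scaleN1r -scalerN opprB /Kh_ /KhV_ !expr2.
  by rewrite -!(K_KVC q).
- by rewrite !opmulE -!scalerAl -!scalerAr e_e // distnC.
- by rewrite !opmulE -!scalerAl -!scalerAr f_f // distnC.
- rewrite !mulr_algl scale0r !opmulE.
  have := congr1 ( *:%R (a ^+ 3)) (e_serre q ij); rewrite scaler0 => <-.
  rewrite -!(scalerAl, scalerAr) scaleN1r !scalerDr !scalerN.
  rewrite !scalerA addrC addrA addrAC expr2 !mulrA.
  by congr (_ *: _ - _ *: _ + _ *: _); rewrite !exprS expr0; ring.
- rewrite !mulr_algl scale0r !opmulE.
  have := congr1 ( *:%R (b ^+ 3)) (f_serre q ij); rewrite scaler0 => <-.
  rewrite -!(scalerAl, scalerAr) scaleN1r !scalerDr !scalerN.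
  rewrite !scalerA addrC addrA addrAC expr2 !mulrA.
  by congr (_ *: _ - _ *: _ + _ *: _); rewrite !exprS expr0; ring.
Qed.

Lemma qCK : q != 0 -> qC q * (qC q)^-1 = 1.
Proof. by move=> q0; rewrite mulfV // eq_complex /= negb_and q0. Qed.

Lemma antipode_coef : - (qC q)^-1 * - qC q = 1 \/ q = 0.
Proof.
by have [->|q0] := eqVneq q 0; [right | left; rewrite mulrNN mulrC qCK].
Qed.

Lemma antipodeV_coef : - qC q * - (qC q)^-1 = 1 \/ q = 0.
Proof. by rewrite mulrC; apply: antipode_coef. Qed.

(* S, and its inverse S^-1 (antipodeK and antipodeVK below). *)
Definition antipode : U -> U := Uq_lift (anti_gen_rel antipode_coef).
Definition antipodeV : U -> U := Uq_lift (anti_gen_rel antipodeV_coef).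

Lemma antipode_e i : antipode (e_ q i) = - (qC q)^-1 *: e_ q i.
Proof. exact: (Uq_lift_gen (anti_gen_rel antipode_coef) (Ge i)). Qed.

Lemma antipode_f i : antipode (f_ q i) = - qC q *: f_ q i.
Proof. exact: (Uq_lift_gen (anti_gen_rel antipode_coef) (Gf i)). Qed.

Lemma antipode_K a : antipode (K_ q a) = KV_ q a.
Proof. exact: (Uq_lift_gen (anti_gen_rel antipode_coef) (GK a)). Qed.

Lemma antipode_KV a : antipode (KV_ q a) = K_ q a.
Proof. exact: (Uq_lift_gen (anti_gen_rel antipode_coef) (GKV a)). Qed.

Lemma antipodeV_e i : antipodeV (e_ q i) = - qC q *: e_ q i.
Proof. exact: (Uq_lift_gen (anti_gen_rel antipodeV_coef) (Ge i)). Qed.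

Lemma antipodeV_f i : antipodeV (f_ q i) = - (qC q)^-1 *: f_ q i.
Proof. exact: (Uq_lift_gen (anti_gen_rel antipodeV_coef) (Gf i)). Qed.

Lemma antipodeV_K a : antipodeV (K_ q a) = KV_ q a.
Proof. exact: (Uq_lift_gen (anti_gen_rel antipodeV_coef) (GK a)). Qed.

Lemma antipodeV_KV a : antipodeV (KV_ q a) = K_ q a.
Proof. exact: (Uq_lift_gen (anti_gen_rel antipodeV_coef) (GKV a)). Qed.

Lemma antipode_linear : linear antipode.
Proof. exact: (linearP (Uq_lift (anti_gen_rel antipode_coef))). Qed.

Lemma antipodeV_linear : linear antipodeV.
Proof. exact: (linearP (Uq_lift (anti_gen_rel antipodeV_coef))). Qed.

HB.instance Definition _ :=
  GRing.isLinear.Build C U U *:%R antipode antipode_linear.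
HB.instance Definition _ :=
  GRing.isLinear.Build C U U *:%R antipodeV antipodeV_linear.

Lemma antipode1 : antipode 1 = 1.
Proof. exact: (rmorph1 (Uq_lift (anti_gen_rel antipode_coef))). Qed.

Lemma antipodeV1 : antipodeV 1 = 1.
Proof. exact: (rmorph1 (Uq_lift (anti_gen_rel antipodeV_coef))). Qed.

Lemma antipodeM x y : antipode (x * y) = antipode y * antipode x.
Proof. exact: (rmorphM (Uq_lift (anti_gen_rel antipode_coef)) x y). Qed.

Lemma antipodeVM x y : antipodeV (x * y) = antipodeV y * antipodeV x.
Proof. exact: (rmorphM (Uq_lift (anti_gen_rel antipodeV_coef)) x y). Qed.

Lemma antipodeK : q != 0 -> cancel antipode antipodeV.
Proof.
move=> q0; apply: Uq_ind.
- by move=> i; rewrite antipode_e linearZ /= antipodeV_e scalerA mulrNN mulrC qCK ?scale1r.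
- by move=> i; rewrite antipode_f linearZ /= antipodeV_f scalerA mulrNN qCK ?scale1r.
- by move=> a; rewrite antipode_K antipodeV_KV.
- by move=> a; rewrite antipode_KV antipodeV_K.
- by move=> c; rewrite !linearZ /= antipode1 antipodeV1.
- by move=> x y Hx Hy; rewrite !linearD /= Hx Hy.
- by move=> x y Hx Hy; rewrite antipodeM antipodeVM Hx Hy.
Qed.

Lemma antipodeVK : q != 0 -> cancel antipodeV antipode.
Proof.
move=> q0; apply: Uq_ind.
- by move=> i; rewrite antipodeV_e linearZ /= antipode_e scalerA mulrNN qCK ?scale1r.
- by move=> i; rewrite antipodeV_f linearZ /= antipode_f scalerA mulrNN mulrC qCK ?scale1r.
- by move=> a; rewrite antipodeV_K antipode_KV.
- by move=> a; rewrite antipodeV_KV antipode_K.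
- by move=> c; rewrite !linearZ /= antipodeV1 antipode1.
- by move=> x y Hx Hy; rewrite !linearD /= Hx Hy.
- by move=> x y Hx Hy; rewrite antipodeVM antipodeM Hx Hy.
Qed.

End Antipode.

(* The algebra morphism U_q(n-1) -> U_q(n) that sends generators to the
   generators with the same index; through it U_q(n-1) is regarded as a
   subalgebra of U_q(n).  Its image is the subalgebra generated by the
   e_i, f_i with i <= n-2 and q^(E_ii/2), q^(-E_ii/2) with i <= n-1
   (subUqP). *)
Section Inclusion.
Context {R : realType}.
Variables (q : R) (n : nat).
Notation U := (Uq q n).
Notation U0 := (Uq q n.-1).
Notation C := R[i].

Definition incl_gen (x : generator n.-1) : U :=
  match x with
  | Ge i => e_ q (lo i) | Gf i => f_ q (lo i)
  | GK a => K_ q (lo a) | GKV a => KV_ q (lo a)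
  end.

Lemma root_pairing_lo (j : 'I_n.-2) (a : 'I_n.-1) :
  root_pairing (lo j) (lo a) = root_pairing j a.
Proof. by rewrite /root_pairing -lo_hi !(inj_eq (@lo_inj n)). Qed.

Lemma incl_gen_rel s t : Uq_rel q s t -> eval incl_gen s = eval incl_gen t.
Proof.
case=> {s t} /= => [a|a|a b|a j|a j|i j|i j ij|i j ij|i j ij|i j ij];
  rewrite ?mulr_algl.
- by rewrite K_KV scale1r.
- by rewrite KV_K scale1r.
- exact: K_K.
- by rewrite K_e root_pairing_lo.
- by rewrite K_f root_pairing_lo.
- by rewrite !scaleN1r e_f (inj_eq (@lo_inj n.-1)) !lo_hi !expr2.
- exact: e_e.
- exact: f_f.
- rewrite scale0r scaleN1r.
  by have := @e_serre _ q n (lo i) (lo j) ij; rewrite expr2 !mulrA.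
- rewrite scale0r scaleN1r.
  by have := @f_serre _ q n (lo i) (lo j) ij; rewrite expr2 !mulrA.
Qed.

Definition incl : U0 -> U := Uq_lift incl_gen_rel.

HB.instance Definition _ := GRing.LRMorphism.on incl.

Lemma incl_e i : incl (e_ q i) = e_ q (lo i).
Proof. exact: (Uq_lift_gen incl_gen_rel (Ge i)). Qed.

Lemma incl_f i : incl (f_ q i) = f_ q (lo i).
Proof. exact: (Uq_lift_gen incl_gen_rel (Gf i)). Qed.

Lemma incl_K a : incl (K_ q a) = K_ q (lo a).
Proof. exact: (Uq_lift_gen incl_gen_rel (GK a)). Qed.

Lemma incl_KV a : incl (KV_ q a) = KV_ q (lo a).
Proof. exact: (Uq_lift_gen incl_gen_rel (GKV a)). Qed.

Inductive subUq : U -> Prop :=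
| subUq_e (i : 'I_n.-2) : subUq (e_ q (lo i))
| subUq_f (i : 'I_n.-2) : subUq (f_ q (lo i))
| subUq_K (a : 'I_n.-1) : subUq (K_ q (lo a))
| subUq_KV (a : 'I_n.-1) : subUq (KV_ q (lo a))
| subUq_1 : subUq 1
| subUq_lin (c : C) x y : subUq x -> subUq y -> subUq (c *: x + y)
| subUq_M x y : subUq x -> subUq y -> subUq (x * y).

Lemma subUqP x : subUq x <-> exists y, x = incl y.
Proof.
split.
- elim.
  + by move=> i; exists (e_ q i); rewrite incl_e.
  + by move=> i; exists (f_ q i); rewrite incl_f.
  + by move=> a; exists (K_ q a); rewrite incl_K.
  + by move=> a; exists (KV_ q a); rewrite incl_KV.
  + by exists 1; rewrite rmorph1.
  + by move=> c _ _ _ [u ->] _ [v ->]; exists (c *: u + v); rewrite linearP.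
  + by move=> _ _ _ [u ->] _ [v ->]; exists (u * v); rewrite rmorphM.
- case=> y ->; elim/(@Uq_ind _ q n.-1): y.
  + by move=> i; rewrite incl_e; apply: subUq_e.
  + by move=> i; rewrite incl_f; apply: subUq_f.
  + by move=> a; rewrite incl_K; apply: subUq_K.
  + by move=> a; rewrite incl_KV; apply: subUq_KV.
  + move=> c; rewrite linearZ /= rmorph1 -(subrK 1 c) scalerDl scale1r.
    by apply: subUq_lin; apply: subUq_1.
  + by move=> u v Hu Hv; rewrite linearD /= -[incl u]scale1r; apply: subUq_lin.
  + by move=> u v Hu Hv; rewrite rmorphM; apply: subUq_M.
Qed.

End Inclusion.

Arguments incl {R} q n x.

Section Atilde.
Context {R : realType}.
Variables (q : R) (n : nat).
Notation U := (Uq q n).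
Notation C := R[i].

Definition qbracket (x y : U) : U := x * y - (qC q)^-1 *: (y * x).

(* e_nat k is the generator e_ i such that i has value k; the 0 returned for
   k out of range never occurs in Eij. *)
Definition e_nat (k : nat) : U :=
  if insub k is Some i then e_ q (i : 'I_n.-1) else 0.
Definition f_nat (k : nat) : U :=
  if insub k is Some i then f_ q (i : 'I_n.-1) else 0.

(* E_(i, i+d+1) and E_(i+d+1, i) *)
Fixpoint E_up (i d : nat) : U :=
  if d is d'.+1 then qbracket (E_up i d') (e_nat (i + d)) else e_nat i.
Fixpoint E_down (i d : nat) : U :=
  if d is d'.+1 then qbracket (f_nat (i + d)) (E_down i d') else f_nat i.

(* E_ij for i != j (the value at i = j is irrelevant).  The recursion uses
   only k = j-1 for i < j and k = i-1 for i > j; that the other values of k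
   give the same element is proved in Eij_lt and Eij_gt. *)
Definition Eij (i j : 'I_n) : U :=
  if (i < j)%N then E_up i (j - i).-1
  else if (j < i)%N then E_down j (i - j).-1 else 0.

Lemma qbracketA x y z : x * z = z * x ->
  qbracket (qbracket x y) z = qbracket x (qbracket y z).
Proof.
move=> xz; rewrite /qbracket; set p := (qC q)^-1.
rewrite !(mulrBl, mulrBr) -!scalerAl -!scalerAr !scalerBr !mulrA.
rewrite -(mulrA y x z) xz !opprB !mulrA; set a := x * y * z.
by rewrite -!addrA; congr (_ + _); rewrite addrC -addrA addrC -!addrA; congr (_ + _); rewrite addrC.
Qed.

Lemma e_natC k m : (k.+1 < m)%N -> e_nat k * e_nat m = e_nat m * e_nat k.
Proof.
move=> km; rewrite /e_nat; case: insubP => [i _ ik|_] /=; last by rewrite mul0r mulr0.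
case: insubP => [j _ jm|_] /=; last by rewrite mul0r mulr0.
by apply: e_e; rewrite distnC; move: ik jm => /= -> ->; lia.
Qed.

Lemma f_natC k m : (k.+1 < m)%N -> f_nat k * f_nat m = f_nat m * f_nat k.
Proof.
move=> km; rewrite /f_nat; case: insubP => [i _ ik|_] /=; last by rewrite mul0r mulr0.
case: insubP => [j _ jm|_] /=; last by rewrite mul0r mulr0.
by apply: f_f; rewrite distnC; move: ik jm => /= -> ->; lia.
Qed.

Lemma E_upC i d m : ((i + d).+1 < m)%N -> E_up i d * e_nat m = e_nat m * E_up i d.
Proof.
elim: d => [|d IHd] dm /=; first by apply: e_natC; lia.
have H1 : e_nat (i + d.+1) * e_nat m = e_nat m * e_nat (i + d.+1).
  by apply: e_natC; lia.
have H2 : E_up i d * e_nat m = e_nat m * E_up i d by apply: IHd; lia.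
rewrite /qbracket mulrBl mulrBr -scalerAl -scalerAr.
by rewrite -!mulrA H1 H2 !mulrA H1 H2.
Qed.

Lemma E_downC i d m :
  ((i + d).+1 < m)%N -> E_down i d * f_nat m = f_nat m * E_down i d.
Proof.
elim: d => [|d IHd] dm /=; first by apply: f_natC; lia.
have H1 : f_nat (i + d.+1) * f_nat m = f_nat m * f_nat (i + d.+1).
  by apply: f_natC; lia.
have H2 : E_down i d * f_nat m = f_nat m * E_down i d by apply: IHd; lia.
rewrite /qbracket mulrBl mulrBr -scalerAl -scalerAr.
by rewrite -!mulrA H1 H2 !mulrA H1 H2.
Qed.

Lemma E_up_split i a b :
  E_up i (a + b).+1 = qbracket (E_up i a) (E_up (i + a).+1 b).
Proof.
elim: b => [|b IHb]; first by rewrite addn0 /= addnS.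
have -> : E_up i (a + b.+1).+1
          = qbracket (E_up i (a + b).+1) (e_nat ((i + a).+1 + b.+1)).
  rewrite addnS -[LHS]/(qbracket (E_up i (a + b).+1) (e_nat (i + (a + b).+2))).
  by congr (qbracket _ (e_nat _)); lia.
by rewrite IHb qbracketA //; apply: E_upC; lia.
Qed.

Lemma E_down_split i a b :
  E_down i (a + b).+1 = qbracket (E_down (i + a).+1 b) (E_down i a).
Proof.
elim: b => [|b IHb]; first by rewrite addn0 /= addnS.
have -> : E_down i (a + b.+1).+1
          = qbracket (f_nat ((i + a).+1 + b.+1)) (E_down i (a + b).+1).
  rewrite addnS -[LHS]/(qbracket (f_nat (i + (a + b).+2)) (E_down i (a + b).+1)).
  by congr (qbracket (f_nat _) _); lia.
by rewrite IHb -qbracketA //; symmetry; apply: E_downC; lia.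
Qed.

Lemma Eij_e (i : 'I_n.-1) : Eij (lo i) (hi i) = e_ q i.
Proof.
by rewrite /Eij /= ltnSn subSnn /= /e_nat valK.
Qed.

Lemma Eij_f (i : 'I_n.-1) : Eij (hi i) (lo i) = f_ q i.
Proof.
by rewrite /Eij /= ltnSn ltnNge leqnSn /= subSnn /= /f_nat valK.
Qed.

Lemma Eij_lt (i k j : 'I_n) : (i < k)%N -> (k < j)%N ->
  Eij i j = Eij i k * Eij k j - (qC q)^-1 *: (Eij k j * Eij i k).
Proof.
move=> ik kj; rewrite /Eij ik kj (ltn_trans ik kj).
rewrite -[RHS]/(qbracket _ _).
have -> : (j - i).-1 = ((k - i).-1 + (j - k).-1).+1 by lia.
by rewrite E_up_split; congr (qbracket _ (E_up _ _)); lia.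
Qed.

Lemma Eij_gt (i k j : 'I_n) : (k < i)%N -> (j < k)%N ->
  Eij i j = Eij i k * Eij k j - (qC q)^-1 *: (Eij k j * Eij i k).
Proof.
move=> ki jk; have ji := ltn_trans jk ki.
rewrite /Eij ki jk ji !ltnNge (ltnW ki) (ltnW jk) (ltnW ji) /=.
rewrite -[RHS]/(qbracket _ _).
have -> : (i - j).-1 = ((k - j).-1 + (i - k).-1).+1 by lia.
by rewrite E_down_split; congr (qbracket (E_down _ _) _); lia.
Qed.

Definition Ehat (i j : 'I_n) : U :=
  if i == j then K_ q i ^+ 2
  else ((qC q - (qC q)^-1) * qhalf q (- 1)) *: (K_ q i * K_ q j * Eij i j).

Definition Atilde (i j : 'I_n) : U :=
  (qC q - (qC q)^-1)^-1 *: ((i == j)%:R -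
    \sum_(k < n | (k <= minn i j)%N) antipodeV (Ehat k i) * antipode (Ehat j k)).

End Atilde.

Section VectorOperators.
Context {R : realType}.
Variables (q : R) (m : nat) (A : algType R[i]) (iota : Uq q m -> A).

(* Families phi_k in an algebra A to which U_q(m) maps by iota. *)
Definition dual_vector_operator (phi : 'I_m -> A) : Prop :=
  [/\ forall i k : 'I_m,
        iota (K_ q i ^+ 2) * phi k =
        (qC q ^ (- (i == k)%:Z)) *: (phi k * iota (K_ q i ^+ 2)),
      forall (i : 'I_m.-1) (k : 'I_m),
        iota (e_ q i) * phi k
          - qhalf q (- root_pairing i k) *: (phi k * iota (e_ q i)) =
        (- (qC q)^-1 * (k == lo i)%:R) *: (phi (hi i) * iota (KhV_ q i)) &
      forall (i : 'I_m.-1) (k : 'I_m),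
        iota (f_ q i) * phi k
          - qhalf q (- root_pairing i k) *: (phi k * iota (f_ q i)) =
        (- qC q * (k == hi i)%:R) *: (phi (lo i) * iota (KhV_ q i))].

Definition vector_operator (psi : 'I_m -> A) : Prop :=
  [/\ forall i k : 'I_m,
        iota (K_ q i ^+ 2) * psi k =
        (qC q ^ (i == k)%:Z) *: (psi k * iota (K_ q i ^+ 2)),
      forall (i : 'I_m.-1) (k : 'I_m),
        iota (e_ q i) * psi k
          - qhalf q (root_pairing i k) *: (psi k * iota (e_ q i)) =
        (k == hi i)%:R *: (psi (lo i) * iota (KhV_ q i)) &
      forall (i : 'I_m.-1) (k : 'I_m),
        iota (f_ q i) * psi k
          - qhalf q (root_pairing i k) *: (psi k * iota (f_ q i)) =
        (k == lo i)%:R *: (psi (hi i) * iota (KhV_ q i))].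

End VectorOperators.

(* Main.v *)
(* Write X_ki = S^-1(Ehat_ki), with X_ki = 0 for k > i, and let theta be the
   anti-involution exchanging e_a and f_a and fixing q^(E_aa/2).  Then
   S(Ehat_jk) = theta(X_kj), so that (q - q^-1) Atilde = 1 - T with
   T_ij = sum_k X_ki theta(X_kj) and theta(T_ij) = T_ji.
   The q-Serre relations give, uniformly in k and i, the exchange relations of
   e_a and f_a with X_ki: a q-commutation, one term acting on the index k and one
   acting on the index i.  In T_ij with j different from a and a+1, the terms
   that act on the summation index k come from X_ki and from theta(X_kj) with
   opposite signs and cancel, which leaves the action on the index i alone.
   With j = n and a <= n-2 this is (3), and for i = n it is (2); theta turns (3)
   into (4). *)

Require Import Defs.
From HB Require Import structures.
From mathcomp Require Import all_boot all_order all_algebra.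
From mathcomp Require Import complex boolp reals ring zify.

Set Implicit Arguments.
Unset Strict Implicit.
Unset Printing Implicit Defensive.

Import Order.TTheory GRing.Theory Num.Theory.
Local Open Scope ring_scope.

(** * Deciding identities in a noncommutative algebra by comparing coefficients *)

Section AlgebraExpressions.
Variables (C : comNzRingType) (A : algType C) (env : nat -> A).

Inductive alg_expr : Type :=
| AVar of nat
| AZero
| AOne
| AOpp of alg_expr
| AScale of C & alg_expr
| AAdd of alg_expr & alg_expr
| AMul of alg_expr & alg_expr.

Fixpoint alg_eval (t : alg_expr) : A :=
  match t with
  | AVar i => env i
  | AZero => 0
  | AOne => 1
  | AOpp s => - alg_eval s
  | AScale c s => c *: alg_eval s
  | AAdd s t => alg_eval s + alg_eval t
  | AMul s t => alg_eval s * alg_eval t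
  end.

(** A bare fixpoint over [Nat.eqb], so that the [cbv] call in [alg_field], which unfolds only listed
    constants, evaluates it on closed words without touching the scalars. *)
Fixpoint word_eqb (v w : seq nat) : bool :=
  match v, w with
  | [::], [::] => true
  | i :: v', j :: w' => if Nat.eqb i j then word_eqb v' w' else false
  | _, _ => false
  end.

Lemma word_eqbP v w : word_eqb v w = (v == w).
Proof.
elim: v w => [|i v IHv] [|j w] //=; rewrite eqseq_cons IHv.
by have -> : Nat.eqb i j = (i == j) by elim: i j => [|i IHi] [|j] //=.
Qed.

Definition expand_scale (c : C) (s : seq (C * seq nat)) : seq (C * seq nat) :=
  map (fun u => (c * u.1, u.2)) s.

Definition expand_mul (s t : seq (C * seq nat)) : seq (C * seq nat) :=
  flatten (map (fun u => map (fun v => (u.1 * v.1, u.2 ++ v.2)) t) s).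

Fixpoint expand (t : alg_expr) : seq (C * seq nat) :=
  match t with
  | AVar i => [:: (1, [:: i])]
  | AZero => [::]
  | AOne => [:: (1, [::])]
  | AOpp s => expand_scale (-1) (expand s)
  | AScale c s => expand_scale c (expand s)
  | AAdd s t => expand s ++ expand t
  | AMul s t => expand_mul (expand s) (expand t)
  end.

Fixpoint word_coef (w : seq nat) (s : seq (C * seq nat)) : C :=
  match s with
  | [::] => 0
  | u :: s' => if word_eqb u.2 w then u.1 + word_coef w s' else word_coef w s'
  end.

Fixpoint word_undup (s : seq (seq nat)) : seq (seq nat) :=
  match s with
  | [::] => [::]
  | w :: s' => if has (word_eqb w) s' then word_undup s' else w :: word_undup s'
  end.

Let word_val (w : seq nat) : A := \prod_(i <- w) env i.
Let expand_val (s : seq (C * seq nat)) : A := \sum_(u <- s) u.1 *: word_val u.2.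

Lemma expand_scaleP c s : expand_val (expand_scale c s) = c *: expand_val s.
Proof.
rewrite /expand_val big_map scaler_sumr.
by apply: eq_bigr => u _; rewrite scalerA.
Qed.

Lemma expandP t : alg_eval t = expand_val (expand t).
Proof.
elim: t => [i|||s IHs|c s IHs|s IHs t IHt|s IHs t IHt] /=.
- by rewrite /expand_val big_seq1 /word_val big_seq1 scale1r.
- by rewrite /expand_val big_nil.
- by rewrite /expand_val big_seq1 /word_val big_nil scale1r.
- by rewrite expand_scaleP IHs scaleN1r.
- by rewrite expand_scaleP IHs.
- by rewrite IHs IHt /expand_val big_cat.
- rewrite IHs IHt /expand_val /expand_mul big_flatten big_map mulr_suml.
  apply: eq_bigr => u _; rewrite big_map mulr_sumr; apply: eq_bigr => v _ /=.
  by rewrite /word_val big_cat -scalerAl -scalerAr scalerA.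
Qed.

Lemma word_undupE s : word_undup s = undup s.
Proof.
elim: s => //= w s ->; rewrite -has_pred1.
by under eq_has => v do rewrite word_eqbP eq_sym.
Qed.

Lemma expand_val_coef W s : uniq W -> {subset map snd s <= W} ->
  expand_val s = \sum_(w <- W) word_coef w s *: word_val w.
Proof.
move=> uW; elim: s => [|u s IHs] sW; rewrite /expand_val.
  by rewrite big_nil big1 // => w _; rewrite scale0r.
rewrite big_cons -/(expand_val s) IHs; last first.
  by move=> w ws; apply: sW; rewrite inE ws orbT.
have uWu : u.2 \in W by apply: sW; rewrite inE eqxx.
(* The head term becomes a sum over the words of [W] equal to [u.2]; as [W] is duplicate-free there
   is just one, so the two sums can be merged. *)
rewrite -[u.1 *: _](big_seq1 +%R u.2 (fun w => u.1 *: word_val w)).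
rewrite -(filter_pred1_uniq uW uWu) big_filter big_mkcond -big_split; apply: eq_bigr => w _ /=.
rewrite word_eqbP eq_sym; case: eqP => _; first by rewrite scalerDl.
by rewrite add0r.
Qed.

(** A conjunction ending in [True], so that repeated [split] leaves one scalar equation for each
    monomial that occurs on either side. *)
Definition same_coefs (s t : seq (C * seq nat)) : Prop :=
  foldr (fun w P => word_coef w s = word_coef w t /\ P) True
    (word_undup (map snd (s ++ t))).

Lemma alg_eval_expand s t :
  same_coefs (expand s) (expand t) -> alg_eval s = alg_eval t.
Proof.
rewrite /same_coefs !expandP word_undupE => st.
set W := undup _ in st.
have WP w : (w \in W) = (w \in map snd (expand s)) || (w \in map snd (expand t)).
  by rewrite mem_undup map_cat mem_cat.
rewrite !(@expand_val_coef W) ?undup_uniq // => [|w|w]; last 2 first.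
- by rewrite WP => ->; rewrite orbT.
- by rewrite WP => ->.
apply: eq_big_seq => w.
by elim: W st {WP} => //= v W IHW [e st]; rewrite inE => /orP[/eqP->|/IHW->]; rewrite ?e.
Qed.

End AlgebraExpressions.

Ltac atom_index x l :=
  match l with
  | x :: _ => constr:(0%N)
  | _ :: ?l' => let k := atom_index x l' in constr:(S k)
  end.
(** The first branch fails exactly when [x] is not yet listed; backtracking then takes the
    second. *)
Ltac atom_add x l :=
  match l with
  | _ => let k := atom_index x l in l
  | _ => constr:(x :: l)
  end.
Ltac alg_atoms x l :=
  match x with
  | ?a + ?b => let l' := alg_atoms a l in alg_atoms b l'
  | ?a * ?b => let l' := alg_atoms a l in alg_atoms b l'
  | - ?a => alg_atoms a l
  | _ *: ?a => alg_atoms a l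
  | ?a ^+ 2 => alg_atoms a l
  | 0 => l
  | 1 => l
  | _ => atom_add x l
  end.
Ltac alg_reify C x l :=
  match x with
  | ?a + ?b => let s := alg_reify C a l in let t := alg_reify C b l in
               constr:(@AAdd C s t)
  | ?a * ?b => let s := alg_reify C a l in let t := alg_reify C b l in
               constr:(@AMul C s t)
  | - ?a => let s := alg_reify C a l in constr:(@AOpp C s)
  | ?c *: ?a => let s := alg_reify C a l in constr:(@AScale C c s)
  | ?a ^+ 2 => let s := alg_reify C a l in constr:(@AMul C s s)
  | 0 => constr:(@AZero C)
  | 1 => constr:(@AOne C)
  | _ => let k := atom_index x l in constr:(@AVar C k)
  end.

(* Reduces an identity in an algebra over the field C to the identities between
   the scalar coefficients of each noncommutative monomial. *)
Ltac alg_field C :=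
  match goal with
  | |- @eq ?T ?x ?y =>
    let l := alg_atoms x (@nil T) in
    let l := alg_atoms y l in
    let s := alg_reify C x l in
    let t := alg_reify C y l in
    apply: (@alg_eval_expand C _ (nth 0 l) s t);
    cbv [same_coefs expand expand_scale expand_mul flatten map foldr cat
         word_undup word_coef word_eqb Nat.eqb has fst snd orb];
    do ?[split]; try first [by ring | by field]
  end.

(** * q-commutation, q-brackets and the q-Serre relation *)

Section QCommutation.
Context {R : realType} {q : R} {n : nat}.
Notation U := (Uq q n).
Notation C := R[i].
Implicit Types (x y z : U) (c d : C).

Definition qcomm c x y := x * y = c *: (y * x).

Lemma qcomm1 x y : qcomm 1 x y <-> GRing.comm x y.
Proof. by rewrite /qcomm scale1r. Qed.

Lemma qcomm_sym c x y : c != 0 -> qcomm c x y -> qcomm c^-1 y x.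
Proof. by move=> c0; rewrite /qcomm => ->; rewrite scalerA mulVf // scale1r. Qed.

Lemma qcommMr c d x y z : qcomm c x y -> qcomm d x z -> qcomm (c * d) x (y * z).
Proof.
move=> xy xz.
rewrite /qcomm mulrA xy -scalerAl -[y * x * z]mulrA xz -scalerAr scalerA.
by rewrite mulrA.
Qed.

Lemma qcommMl c d x y z : qcomm c x z -> qcomm d y z -> qcomm (c * d) (x * y) z.
Proof.
move=> xz yz.
rewrite /qcomm -mulrA yz -scalerAr [x * (z * y)]mulrA xz -scalerAl scalerA.
by rewrite mulrA mulrC.
Qed.

Lemma qcommBr c x y z : qcomm c x y -> qcomm c x z -> qcomm c x (y - z).
Proof. by rewrite /qcomm mulrBr mulrBl scalerBr => -> ->. Qed.

Lemma qcommZr c d x y : qcomm c x y -> qcomm c x (d *: y).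
Proof.
by rewrite /qcomm -scalerAr -scalerAl => ->; rewrite !scalerA mulrC.
Qed.

Lemma qcomm_bracket c d x y z :
  qcomm c x y -> qcomm d x z -> qcomm (c * d) x (qbracket y z).
Proof.
move=> xy xz; apply: qcommBr; first exact: qcommMr.
by apply: qcommZr; rewrite mulrC; apply: qcommMr.
Qed.

(** Reduced to [qcomm_bracket] by exchanging the two sides, which inverts the factors; hence they
    must be nonzero. *)
Lemma qcomm_bracketl c d x y z : c != 0 -> d != 0 ->
  qcomm c y x -> qcomm d z x -> qcomm (c * d) (qbracket y z) x.
Proof.
move=> c0 d0 yx zx; rewrite -[c * d]invrK.
apply: qcomm_sym; first by rewrite invr_eq0 mulf_neq0.
by rewrite invfM; apply: qcomm_bracket; apply: qcomm_sym.
Qed.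

Lemma comm_bracket x y z :
  GRing.comm x y -> GRing.comm x z -> GRing.comm x (qbracket y z).
Proof.
move=> /qcomm1 xy /qcomm1 xz; apply/qcomm1; rewrite -[1]mulr1.
exact: qcomm_bracket.
Qed.

Definition qserre x y :=
  x ^+ 2 * y - (qC q + (qC q)^-1) *: (x * y * x) + y * x ^+ 2 = 0.

Hypothesis q_neq0 : qC q != 0.

(** Expanded, the difference of the two sides is exactly the q-Serre polynomial. *)
Lemma qserre_bracketl x y : qserre x y -> qcomm (qC q) x (qbracket x y).
Proof.
rewrite /qserre /qcomm /qbracket => serre; apply/subr0_eq; rewrite -serre.
by alg_field (R[i]).
Qed.

Lemma qserre_bracketr x y : qserre x y -> qcomm (qC q) (qbracket y x) x.
Proof.
rewrite /qserre /qcomm /qbracket => serre; apply/subr0_eq; rewrite -serre.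
by alg_field (R[i]).
Qed.

(* Moving y past P = [W, z] = [x, V], with W = [x, y] and V = [y, z], leaves
   the same remainder [W, V] from either side. *)
Lemma qserre_middle x y z : 1 + qC q ^+ 2 != 0 ->
  x * z = z * x -> qserre y x -> qserre y z ->
  GRing.comm y (qbracket (qbracket x y) z).
Proof.
move=> q2 xz /qserre_bracketr Wy /qserre_bracketl yV.
set P := qbracket _ z.
pose W := qbracket x y; pose V := qbracket y z.
have Py : P * y - qC q ^+ 2 *: (y * P) + qC q *: (W * V - V * W) = 0.
  have -> : P * y - qC q ^+ 2 *: (y * P) + qC q *: (W * V - V * W) =
      - (qC q)^-1 *: (z * (W * y - qC q *: (y * W)))
      + qC q *: ((W * y - qC q *: (y * W)) * z).
    by rewrite /P /V -/W /qbracket; alg_field (R[i]).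
  by rewrite Wy subrr mulr0 mul0r !scaler0 addr0.
have yP : y * P - qC q ^+ 2 *: (P * y) + qC q *: (W * V - V * W) = 0.
  have -> : y * P - qC q ^+ 2 *: (P * y) + qC q *: (W * V - V * W) =
      - (qC q)^-1 *: ((y * V - qC q *: (V * y)) * x)
      + qC q *: (x * (y * V - qC q *: (V * y))).
    rewrite /P (qbracketA y xz) -/V /W /qbracket; by alg_field (R[i]).
  by rewrite yV subrr mulr0 mul0r !scaler0 addr0.
(* The difference of [yP] and [Py] is [(1 + q^2) (y P - P y)], whose scalar factor is invertible. *)
apply/subr0_eq/(scalerI q2); rewrite scaler0 -[RHS](subrr 0) -{1}yP -Py.
by alg_field (R[i]).
Qed.

End QCommutation.

(** * Powers of the square root of q *)

Section HalfPowers.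
Context {R : realType} {q : R}.
Hypothesis hq : 0 < q.

Lemma qC_neq0 : qC q != 0.
Proof. by rewrite /qC eq_complex /= negb_and gt_eqF. Qed.

Lemma qC_sqrD1_neq0 : 1 + qC q ^+ 2 != 0.
Proof.
rewrite /qC -rmorphXn /= -[1](rmorph1 (real_complex R)) -rmorphD /=.
by rewrite eq_complex /= negb_and gt_eqF // addr_gt0 ?exprn_gt0.
Qed.

Lemma sqrt_qC_neq0 : (Num.sqrt q)%:C%C != 0 :> R[i].
Proof. by rewrite eq_complex /= negb_and gt_eqF // sqrtr_gt0. Qed.

Lemma qhalf_neq0 z : qhalf q z != 0.
Proof. by rewrite /qhalf expfz_neq0 // sqrt_qC_neq0. Qed.

Lemma qhalfD y z : qhalf q (y + z) = qhalf q y * qhalf q z.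
Proof. by rewrite /qhalf expfzDr // sqrt_qC_neq0. Qed.

Lemma qhalfN z : qhalf q (- z) = (qhalf q z)^-1.
Proof. by rewrite /qhalf invr_expz. Qed.

Lemma qhalf0 : qhalf q 0 = 1.
Proof. by rewrite /qhalf expr0z. Qed.

Lemma qhalf1_sqr : qhalf q 1 ^+ 2 = qC q.
Proof. by rewrite /qhalf expr1z -rmorphXn /= sqr_sqrtr ?ltW. Qed.

Lemma qC_subV_neq0 : q != 1 -> qC q - (qC q)^-1 != 0.
Proof.
move=> q1; apply: contraNneq q1 => /eqP; rewrite subr_eq0 => /eqP qV.
have : qC q ^+ 2 = 1 by rewrite expr2 {2}qV mulfV ?qC_neq0.
rewrite /qC -rmorphXn /= -(rmorph1 (real_complex R)) => /complexI /eqP.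
by rewrite sqrf_eq1 => /orP[/eqP->//|/eqP q1]; move: hq; rewrite q1 ltr0N1.
Qed.

End HalfPowers.

(** * Weights of the root vectors and their relations with the [e_a] *)

Section RootVectors.
Context {R : realType} {q : R} {n : nat}.
Hypothesis hq : 0 < q.
Notation U := (Uq q n).
Notation C := R[i].
Implicit Types (a : 'I_n.-1) (b i k : 'I_n) (x y : U).

Lemma qcommVl c x x' y : c != 0 -> x' * x = 1 -> x * x' = 1 ->
  qcomm c x y -> qcomm c^-1 x' y.
Proof.
move=> c0 x'x xx' xy; rewrite /qcomm -[RHS]mul1r -x'x -mulrA -scalerAr.
rewrite [x * (y * x')]mulrA xy -scalerAl scalerA mulVf // scale1r.
by rewrite -[y * x * x']mulrA xx' mulr1.
Qed.

Lemma K_mul_e b a : qcomm (qhalf q (root_pairing a b)) (K_ q b) (e_ q a).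
Proof. by rewrite /qcomm scalerAl -K_e -[RHS]mulrA KV_K mulr1. Qed.

Lemma K_mul_f b a : qcomm (qhalf q (- root_pairing a b)) (K_ q b) (f_ q a).
Proof. by rewrite /qcomm scalerAl -K_f -[RHS]mulrA KV_K mulr1. Qed.

(** The coefficient of eps_b in the root eps_k - eps_i, that is, the exponent of q^(1/2) picked up
    when [K_ q b] passes [Eij q k i]. *)
Definition weight k i b : int := (k == b)%:Z - (i == b)%:Z.

Lemma K_mul_e_nat b (m : nat) :
  qcomm (qhalf q ((m == b)%:Z - (m.+1 == b)%:Z)) (K_ q b) (e_nat q n m).
Proof.
rewrite /e_nat; case: insubP => [a _ <-|_] /=; last first.
  by rewrite /qcomm mulr0 mul0r scaler0.
have := K_mul_e b a; rewrite /root_pairing -!val_eqE /=.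
by rewrite !(eq_sym (b : nat)).
Qed.

Lemma K_mul_E_up b (k d : nat) :
  qcomm (qhalf q ((k == b)%:Z - ((k + d).+1 == b)%:Z)) (K_ q b) (E_up q n k d).
Proof.
elim: d => [|d IHd] /=; first by rewrite addn0; apply: K_mul_e_nat.
(* The weights of the two bracket factors telescope at their common index. *)
have -> : (k == b)%:Z - ((k + d.+1).+1 == b)%:Z =
    (k == b)%:Z - ((k + d).+1 == b)%:Z
    + (((k + d.+1)%N == b)%:Z - ((k + d.+1).+1 == b)%:Z).
  by rewrite addnS; ring.
rewrite qhalfD //; apply: qcomm_bracket => //; exact: K_mul_e_nat.
Qed.

Lemma K_mul_Eij b k i : (k < i)%N ->
  qcomm (qhalf q (weight k i b)) (K_ q b) (Eij q k i).
Proof.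
move=> ki; have := K_mul_E_up b k (i - k).-1.
by rewrite /Eij ki (_ : (k + (i - k).-1).+1 = i) //; lia.
Qed.

Lemma Kh_mul_qcomm a x (c d : C) : d != 0 ->
  qcomm c (K_ q (lo a)) x -> qcomm d (K_ q (hi a)) x -> qcomm (c / d) (Kh_ q a) x.
Proof.
move=> d0 cx dx; apply: qcommMl => //.
exact: qcommVl d0 (KV_K _ _) (K_KV _ _) dx.
Qed.

Lemma Kh_KhV a : Kh_ q a * KhV_ q a = 1.
Proof.
by rewrite /Kh_ /KhV_ -mulrA (mulrA (KV_ _ _)) KV_KV -mulrA KV_K mulr1 K_KV.
Qed.

Lemma KhV_Kh a : KhV_ q a * Kh_ q a = 1.
Proof.
by rewrite /Kh_ /KhV_ -mulrA (mulrA (K_ _ _)) K_K -mulrA K_KV mulr1 KV_K.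
Qed.

Lemma Kh_mul_Eij a k i : (k < i)%N ->
  qcomm (qhalf q (root_pairing a k - root_pairing a i)) (Kh_ q a) (Eij q k i).
Proof.
move=> ki; have -> : root_pairing a k - root_pairing a i =
    weight k i (lo a) - weight k i (hi a).
  by rewrite /root_pairing /weight; ring.
rewrite qhalfD // qhalfN.
apply: Kh_mul_qcomm; rewrite ?qhalf_neq0 //; exact: K_mul_Eij.
Qed.

Lemma KhV_mul_Eij a k i : (k < i)%N ->
  qcomm (qhalf q (root_pairing a i - root_pairing a k)) (KhV_ q a) (Eij q k i).
Proof.
move=> ki; rewrite -[_ - _]opprB qhalfN.
apply: qcommVl (Kh_mul_Eij a ki); [exact: qhalf_neq0|exact: KhV_Kh|exact: Kh_KhV].
Qed.

Lemma e_nat_val a : e_nat q n a = e_ q a.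
Proof. by rewrite /e_nat valK. Qed.

(** The root vector is an iterated bracket of [e_k], ..., [e_(k+d)], so commuting with these is
    enough. *)
Lemma comm_E_up x (k d : nat) :
  (forall m, (k <= m <= k + d)%N -> GRing.comm x (e_nat q n m)) ->
  GRing.comm x (E_up q n k d).
Proof.
elim: d => [|d IHd] xe /=; first by apply: xe; lia.
by apply: comm_bracket; [apply: IHd => m km; apply: xe; lia | apply: xe; lia].
Qed.

Lemma comm_Eij x k i : (k < i)%N ->
  (forall m, (k <= m < i)%N -> GRing.comm x (e_nat q n m)) ->
  GRing.comm x (Eij q k i).
Proof. by move=> ki xe; rewrite /Eij ki; apply: comm_E_up => m km; apply: xe; lia. Qed.

Lemma e_Eij_comm a k i : (k < i)%N -> (a.+1 < k)%N || (i < a)%N ->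
  GRing.comm (e_ q a) (Eij q k i).
Proof.
move=> ki aki; apply: comm_Eij => // m km; rewrite -e_nat_val.
have [am|ma] := ltnP a m; first by apply: e_natC; lia.
by symmetry; apply: e_natC; lia.
Qed.

Lemma f_e_nat_comm a (m : nat) : m != a -> GRing.comm (f_ q a) (e_nat q n m).
Proof.
rewrite /e_nat; case: insubP => [c _ <-|_] /= ma; last exact: commr0.
apply/esym/subr0_eq; rewrite e_f.
by rewrite -val_eqE (negPf ma) mul0r scale0r.
Qed.

Lemma f_Eij_comm a k i : (k < i)%N -> (a < k)%N || (i <= a)%N ->
  GRing.comm (f_ q a) (Eij q k i).
Proof. by move=> ki aki; apply: comm_Eij => // m km; apply: f_e_nat_comm; lia. Qed.

Lemma Eij_comm k i k' i' : (k < i)%N -> (i < k')%N -> (k' < i')%N ->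
  GRing.comm (Eij q k i) (Eij q k' i').
Proof.
move=> ki ik' ki'; apply: comm_Eij => // m km.
by rewrite /Eij ki /GRing.comm E_upC //; lia.
Qed.

Lemma Eij_lt_bracket k b i : (k < b)%N -> (b < i)%N ->
  Eij q k i = qbracket (Eij q k b) (Eij q b i).
Proof. exact: Eij_lt. Qed.

Lemma e_qserre a a' : `|a - a'|%N = 1%N -> qserre (e_ q a) (e_ q a').
Proof. exact: e_serre. Qed.

(** Provides the neighbouring simple root a+1; [hi_below] provides a-1. *)
Lemma lo_above a i : (hi a < i)%N -> exists a', lo a' = hi a.
Proof.
move=> ai; have an : (a.+1 < n.-1)%N by have := ltn_ord i; move: ai => /=; lia.
by exists (Ordinal an); apply: val_inj.
Qed.

Lemma hi_below a k : (k < lo a)%N -> exists a', hi a' = lo a.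
Proof.
move=> ka; have an : (a.-1 < n.-1)%N by have := ltn_ord a; lia.
by exists (Ordinal an); apply: val_inj => /=; move: ka => /=; lia.
Qed.

(** For the bracket of [e_a] and [e_(a+1)] this is the q-Serre relation. A longer root vector is the
    bracket of that one with a root vector starting at a+2, which commutes with [e_a]. *)
Lemma e_Eij_lo a i : (hi a < i)%N -> qcomm (qC q) (e_ q a) (Eij q (lo a) i).
Proof.
move=> ai; have [a' a'E] := lo_above ai.
have aa' : a' = a.+1 :> nat by have := congr1 val a'E.
have core : qcomm (qC q) (e_ q a) (Eij q (lo a) (hi a')).
  rewrite (@Eij_lt_bracket _ (hi a)) ?Eij_e -?a'E ?Eij_e //=; try lia.
  apply: qserre_bracketl; [exact: qC_neq0|apply: e_qserre; lia].
have [<-//|ia'] := eqVneq (hi a') i.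
have {}ia' : (hi a' < i)%N by move: ia' ai; rewrite -val_eqE /=; lia.
rewrite (@Eij_lt_bracket _ (hi a')) //=; last by lia.
rewrite -[qC q]mulr1; apply: qcomm_bracket => //.
by apply/qcomm1/e_Eij_comm => //=; lia.
Qed.

Lemma Eij_e_hi a k : (k < lo a)%N -> qcomm (qC q) (Eij q k (hi a)) (e_ q a).
Proof.
move=> ka; have [a' a'E] := hi_below ka.
have aa' : a = a'.+1 :> nat by have := congr1 val a'E.
have core : qcomm (qC q) (Eij q (lo a') (hi a)) (e_ q a).
  rewrite (@Eij_lt_bracket _ (lo a)) ?Eij_e -?a'E ?Eij_e //=; try lia.
  apply: qserre_bracketr; [exact: qC_neq0|apply: e_qserre; lia].
have [->//|ka'] := eqVneq k (lo a').
have {}ka' : (k < lo a')%N by move: ka' ka; rewrite -val_eqE /=; lia.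
rewrite (@Eij_lt_bracket _ (lo a')) //=; last by lia.
rewrite -[qC q]mul1r; apply: qcomm_bracketl; rewrite ?oner_neq0 ?qC_neq0 //.
by apply/qcomm1/esym/e_Eij_comm => //=; move: ka' => /=; lia.
Qed.

(** For the three consecutive simple roots a-1, a, a+1 this is [qserre_middle]. The root vector is
    then extended to the left and to the right by factors built from generators not adjacent to
    [e_a]. *)
Lemma e_Eij_inside a k i : (k < lo a)%N -> (hi a < i)%N ->
  GRing.comm (e_ q a) (Eij q k i).
Proof.
move=> ka ai; have [c cE] := hi_below ka; have [d dE] := lo_above ai.
have ca : a = c.+1 :> nat by have := congr1 val cE.
have da : d = a.+1 :> nat by have := congr1 val dE.
have cElo : Eij q (lo c) (lo a) = e_ q c by rewrite -cE Eij_e.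
have dElo : Eij q (hi a) (hi d) = e_ q d by rewrite -dE Eij_e.
have cae : Eij q (lo c) (hi a) = qbracket (e_ q c) (e_ q a).
  by rewrite (@Eij_lt_bracket _ (lo a)) ?cElo ?Eij_e //=; lia.
have core : GRing.comm (e_ q a) (Eij q (lo c) (hi d)).
  rewrite (@Eij_lt_bracket _ (hi a)) ?cae ?dElo /=; try lia.
  apply: qserre_middle; rewrite ?qC_neq0 ?qC_sqrD1_neq0 //.
  - by apply: e_e; lia.
  - by apply: e_qserre; lia.
  - by apply: e_qserre; lia.
have {}core : GRing.comm (e_ q a) (Eij q k (hi d)).
  have [->//|kc] := eqVneq k (lo c).
  have {}kc : (k < lo c)%N by move: kc ka; rewrite -val_eqE /=; lia.
  rewrite (@Eij_lt_bracket _ (lo c)) //=; last by lia.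
  by apply: comm_bracket => //; apply: e_Eij_comm => //=; lia.
have [<-//|id] := eqVneq (hi d) i.
have {}id : (hi d < i)%N by move: id ai; rewrite -val_eqE /=; lia.
rewrite (@Eij_lt_bracket _ (hi d)) //=; last by move: ka => /=; lia.
by apply: comm_bracket => //; apply: e_Eij_comm => //=; lia.
Qed.
End RootVectors.

(** * Relations of the root vectors with the [f_a] *)

Section LOperator.
Context {R : realType} {q : R} {n : nat}.
Hypothesis hq : 0 < q.
Hypothesis hq1 : q != 1.
Notation U := (Uq q n).
Notation C := R[i].
Implicit Types (a : 'I_n.-1) (b i k : 'I_n) (x y : U).

Let qC0 : qC q != 0. Proof. exact: qC_neq0. Qed.
Let lam0 : qC q - (qC q)^-1 != 0. Proof. exact: qC_subV_neq0. Qed.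
Let lam0' : qC q ^+ 2 - 1 != 0.
Proof.
apply: contraNneq lam0 => q2; have /(canRL (mulfK qC0)) -> : (qC q - (qC q)^-1) * qC q = 0.
  by rewrite mulrBl mulVf // -expr2.
by rewrite mul0r.
Qed.

Lemma root_pairing_at_lo a : root_pairing a (lo a) = 1.
Proof. by rewrite /root_pairing eqxx -val_eqE /= ltn_eqF. Qed.

Lemma root_pairing_at_hi a : root_pairing a (hi a) = -1.
Proof. by rewrite /root_pairing eqxx -val_eqE /= gtn_eqF. Qed.

Lemma root_pairing_neq a i : i != lo a -> i != hi a -> root_pairing a i = 0.
Proof. by rewrite /root_pairing => /negPf-> /negPf->. Qed.

Lemma qcomm_sqr c x y : qcomm c x y -> qcomm (c ^+ 2) (x ^+ 2) y.
Proof. by move=> xy; rewrite !expr2; apply: qcommMl. Qed.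

Lemma e_f_comm a : e_ q a * f_ q a - f_ q a * e_ q a =
  (qC q - (qC q)^-1)^-1 *: (Kh_ q a ^+ 2 - KhV_ q a ^+ 2).
Proof. by rewrite e_f eqxx div1r. Qed.

Lemma ord_ltn_neq i k : (k < i)%N -> k != i.
Proof. by move=> ki; rewrite -val_eqE ltn_eqF. Qed.

Lemma lo_ltn_hi a : (lo a < hi a)%N.
Proof. exact: ltnSn. Qed.

Lemma ltn_lo_hi a k : (k < lo a)%N -> (k < hi a)%N.
Proof. by move=> ka; apply: ltn_trans ka (lo_ltn_hi a). Qed.

Lemma ltn_hi_lo a i : (hi a < i)%N -> (lo a < i)%N.
Proof. exact: ltn_trans. Qed.

Lemma root_pairing_ltn a k : (k < lo a)%N -> root_pairing a k = 0.
Proof. by move=> ka; rewrite root_pairing_neq // ord_ltn_neq // ltn_lo_hi. Qed.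

Lemma root_pairing_gtn a i : (hi a < i)%N -> root_pairing a i = 0.
Proof. by move=> ai; rewrite root_pairing_neq // eq_sym ord_ltn_neq // ltn_hi_lo. Qed.

Lemma Kh2_Eij_lo a k : (k < lo a)%N ->
  Eij q k (lo a) * Kh_ q a ^+ 2 = qC q *: (Kh_ q a ^+ 2 * Eij q k (lo a)).
Proof.
move=> ka; have /qcomm_sqr := Kh_mul_Eij hq a ka.
rewrite root_pairing_at_lo root_pairing_ltn // sub0r qhalfN exprVn qhalf1_sqr // => ->.
by rewrite scalerA mulfV // scale1r.
Qed.

Lemma KhV2_Eij_lo a k : (k < lo a)%N ->
  Eij q k (lo a) * KhV_ q a ^+ 2 = (qC q)^-1 *: (KhV_ q a ^+ 2 * Eij q k (lo a)).
Proof.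
move=> ka; have /qcomm_sqr := KhV_mul_Eij hq a ka.
rewrite root_pairing_at_lo root_pairing_ltn // subr0 qhalf1_sqr // => ->.
by rewrite scalerA mulVf // scale1r.
Qed.

Lemma Kh2_Eij_hi a i : (hi a < i)%N ->
  Eij q (hi a) i * Kh_ q a ^+ 2 = qC q *: (Kh_ q a ^+ 2 * Eij q (hi a) i).
Proof.
move=> ai; have /qcomm_sqr := Kh_mul_Eij hq a ai.
rewrite root_pairing_at_hi root_pairing_gtn // subr0 qhalfN exprVn qhalf1_sqr // => ->.
by rewrite scalerA mulfV // scale1r.
Qed.

Lemma KhV2_Eij_hi a i : (hi a < i)%N ->
  Eij q (hi a) i * KhV_ q a ^+ 2 = (qC q)^-1 *: (KhV_ q a ^+ 2 * Eij q (hi a) i).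
Proof.
move=> ai; have /qcomm_sqr := KhV_mul_Eij hq a ai.
rewrite root_pairing_at_hi root_pairing_gtn // sub0r opprK qhalf1_sqr // => ->.
by rewrite scalerA mulVf // scale1r.
Qed.

(** Since [f_a] commutes with [Eij q k (lo a)], only the commutator of [e_a] and [f_a] inside the
    bracket contributes. *)
Lemma Eij_hi_f a k : (k < lo a)%N ->
  Eij q k (hi a) * f_ q a = f_ q a * Eij q k (hi a) + Kh_ q a ^+ 2 * Eij q k (lo a).
Proof.
move=> ka; rewrite (@Eij_lt_bracket _ _ _ _ (lo a)) // Eij_e /qbracket.
have fE : GRing.comm (f_ q a) (Eij q k (lo a)) by apply: f_Eij_comm; rewrite // leqnn orbT.
have KE := Kh2_Eij_lo ka; have KVE := KhV2_Eij_lo ka; have ef := e_f_comm a.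
set E := Eij _ _ _ in fE KE KVE *; set D := _ *: (_ - _) in ef.
(* The two [KhV] terms cancel, while the [Kh] terms have total factor q - q^-1, which removes the
   denominator of [D]. *)
have ED : E * D - (qC q)^-1 *: (D * E) = Kh_ q a ^+ 2 * E.
  rewrite /D -scalerAr -scalerAl mulrBr KE KVE.
  by alg_field (R[i]); field; rewrite qC0 -expr2 lam0'.
apply/eqP; rewrite addrC -subr_eq -ED -ef -subr_eq0; apply/eqP.
set lhs := (X in X = 0).
have -> : lhs = (E * f_ q a - f_ q a * E) * e_ q a
    - (qC q)^-1 *: (e_ q a * (E * f_ q a - f_ q a * E)).
  by rewrite /lhs; alg_field (R[i]).
by rewrite -fE subrr mul0r mulr0 scaler0 subr0.
Qed.

Lemma Eij_lo_f a i : (hi a < i)%N ->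
  Eij q (lo a) i * f_ q a =
  f_ q a * Eij q (lo a) i - (qC q)^-1 *: (KhV_ q a ^+ 2 * Eij q (hi a) i).
Proof.
move=> ai; rewrite (@Eij_lt_bracket _ _ _ _ (hi a)) // Eij_e /qbracket.
have fE : GRing.comm (f_ q a) (Eij q (hi a) i) by apply: f_Eij_comm; rewrite // ltnSn.
have KE := Kh2_Eij_hi ai; have KVE := KhV2_Eij_hi ai; have ef := e_f_comm a.
set E := Eij _ _ _ in fE KE KVE *; set D := _ *: (_ - _) in ef.
(* With the order reversed it is the [Kh] terms that cancel and the [KhV] terms that survive. *)
have DE : D * E - (qC q)^-1 *: (E * D) = - ((qC q)^-1 *: (KhV_ q a ^+ 2 * E)).
  rewrite /D -scalerAr -scalerAl mulrBr KE KVE.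
  by alg_field (R[i]); field; rewrite qC0 -expr2 lam0'.
apply/eqP; rewrite addrC -subr_eq -DE -ef -subr_eq0; apply/eqP.
set lhs := (X in X = 0).
have -> : lhs = e_ q a * (E * f_ q a - f_ q a * E)
    - (qC q)^-1 *: ((E * f_ q a - f_ q a * E) * e_ q a).
  by rewrite /lhs; alg_field (R[i]).
by rewrite -fE subrr mul0r mulr0 scaler0 subr0.
Qed.

(** Splitting at [hi a], the term created by [Eij_hi_f] enters the bracket as [Kh^2] times the
    commutator of [Eij q k (lo a)] and [Eij q (hi a) i], which vanishes. *)
Lemma f_Eij_inside a k i : (k < lo a)%N -> (hi a < i)%N ->
  GRing.comm (f_ q a) (Eij q k i).
Proof.
move=> ka ai; rewrite (@Eij_lt_bracket _ _ _ _ (hi a)) ?ltn_lo_hi // /qbracket.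
have fE : GRing.comm (f_ q a) (Eij q (hi a) i) by apply: f_Eij_comm; rewrite // ltnSn.
have fW := Eij_hi_f ka; have KE := Kh2_Eij_hi ai.
have EE : GRing.comm (Eij q k (lo a)) (Eij q (hi a) i) by apply: Eij_comm.
set E := Eij _ (hi a) i in fE EE KE *; set W := Eij _ _ _ in fW *.
set E' := Eij _ _ _ in fW EE; apply/subr0_eq; set lhs := (X in X = 0).
have -> : lhs = (qC q)^-1 *: ((E * f_ q a - f_ q a * E) * W)
    - W * (E * f_ q a - f_ q a * E)
    + (f_ q a * W + Kh_ q a ^+ 2 * E' - W * f_ q a) * E
    - (qC q)^-1 *: (E * (f_ q a * W + Kh_ q a ^+ 2 * E' - W * f_ q a))
    + (qC q)^-1 *: ((E * Kh_ q a ^+ 2 - qC q *: (Kh_ q a ^+ 2 * E)) * E')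
    - Kh_ q a ^+ 2 * (E' * E - E * E').
  by rewrite /lhs; alg_field (R[i]).
by rewrite fW KE EE fE !(subrr, mulr0, mul0r, scaler0, addr0).
Qed.
End LOperator.

(** * Exchange relations for the upper triangular matrix of the [Ehat] *)

Section UpperMatrix.
Context {R : realType} {q : R} {n : nat}.
Hypothesis hq : 0 < q.
Hypothesis hq1 : q != 1.
Notation U := (Uq q n).
Notation C := R[i].
Implicit Types (a : 'I_n.-1) (b i k : 'I_n) (x y : U).

Let qC0 : qC q != 0. Proof. exact: qC_neq0. Qed.
Let lam0 : qC q - (qC q)^-1 != 0. Proof. exact: qC_subV_neq0. Qed.

(** The indices of the family let one case analysis evaluate the pairing and both Kronecker symbols
    of the exchange relations. *)
Variant position_spec a i : int -> bool -> bool -> Prop :=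
| PositionBelow of (i < lo a)%N : position_spec a i 0 false false
| PositionLo of i = lo a : position_spec a i 1 true false
| PositionHi of i = hi a : position_spec a i (-1) false true
| PositionAbove of (hi a < i)%N : position_spec a i 0 false false.

Lemma positionP a i : position_spec a i (root_pairing a i) (i == lo a) (i == hi a).
Proof.
have [->|il] := eqVneq i (lo a).
  by rewrite root_pairing_at_lo (negPf (ord_ltn_neq (lo_ltn_hi a))); constructor.
have [->|ih] := eqVneq i (hi a); first by rewrite root_pairing_at_hi; constructor.
rewrite root_pairing_neq //; have [ia|ia] := ltnP i (lo a); first by constructor.
by apply: PositionAbove; move: il ih ia; rewrite -!val_eqE /=; lia.
Qed.

(** The extension by zero below the diagonal makes the exchange relations uniform in k and i, and
    later turns the restricted sum in [Atilde] into a full one. *)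
Definition Lup k i : U := if (k <= i)%N then Ehat q k i else 0.

Definition Lcoef : C := (qC q - (qC q)^-1) * qhalf q (- 1).

Lemma Lup_lt k i : (k < i)%N -> Lup k i = Lcoef *: (K_ q k * K_ q i * Eij q k i).
Proof. by move=> ki; rewrite /Lup ltnW // /Ehat (negPf (ord_ltn_neq ki)). Qed.

Lemma Lup_diag k : Lup k k = K_ q k ^+ 2.
Proof. by rewrite /Lup leqnn /Ehat eqxx. Qed.

Lemma Lup_gt k i : (i < k)%N -> Lup k i = 0.
Proof. by rewrite /Lup ltnNge => /negPf->. Qed.

Lemma KK_e a k i : qcomm (qhalf q (root_pairing a k + root_pairing a i))
  (K_ q k * K_ q i) (e_ q a).
Proof. by rewrite qhalfD //; apply: qcommMl; apply: K_mul_e. Qed.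

Lemma KK_f a k i : qcomm (qhalf q (- (root_pairing a k + root_pairing a i)))
  (K_ q k * K_ q i) (f_ q a).
Proof. by rewrite opprD qhalfD //; apply: qcommMl; apply: K_mul_f. Qed.

(** Reduces every strictly upper triangular case, for [e_a] and for [f_a], to a relation of the bare
    root vector. *)
Lemma Lup_lt_mul k i (c d : C) x y : (k < i)%N ->
  qcomm d (K_ q k * K_ q i) x -> Eij q k i * x = c *: (x * Eij q k i) + y ->
  Lup k i * x = (d * c) *: (x * Lup k i) + Lcoef *: (K_ q k * K_ q i * y).
Proof.
move=> ki dx Ex; rewrite (Lup_lt ki) -scalerAl -[_ * x]mulrA Ex mulrDr scalerDr.
congr (_ + _); rewrite -!scalerAr [_ * (x * _)]mulrA dx -!scalerAl !scalerA.
rewrite -[x * _ * _]mulrA; congr (_ *: _); ring.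
Qed.

(** This and the next lemmas exchange [lo a] and [hi a] in the Cartan prefactor, so that correction
    terms can be recognised as neighbouring entries of [Lup]. *)
Lemma Kh_K_hi a : Kh_ q a * K_ q (hi a) = K_ q (lo a).
Proof. by rewrite /Kh_ -mulrA KV_K mulr1. Qed.

Lemma KhV_K_lo a : KhV_ q a * K_ q (lo a) = K_ q (hi a).
Proof. by rewrite /KhV_ -mulrA K_K mulrA KV_K mul1r. Qed.

Lemma Kh_KC a b : Kh_ q a * K_ q b = K_ q b * Kh_ q a.
Proof. by rewrite /Kh_ -mulrA -K_KVC mulrA K_K mulrA. Qed.

Lemma KhV_KC a b : KhV_ q a * K_ q b = K_ q b * KhV_ q a.
Proof. by rewrite /KhV_ -mulrA K_K mulrA -K_KVC mulrA. Qed.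

Lemma Kh_KK_hi a k : Kh_ q a * (K_ q k * K_ q (hi a)) = K_ q k * K_ q (lo a).
Proof. by rewrite mulrA Kh_KC -mulrA Kh_K_hi. Qed.

Lemma KhV_KK_lo a i : KhV_ q a * (K_ q (lo a) * K_ q i) = K_ q (hi a) * K_ q i.
Proof. by rewrite mulrA KhV_K_lo. Qed.

Lemma KK_hi_Kh2 a k : K_ q k * K_ q (hi a) * Kh_ q a ^+ 2 =
  Kh_ q a * (K_ q k * K_ q (lo a)).
Proof.
have KKC : Kh_ q a * (K_ q k * K_ q (hi a)) = K_ q k * K_ q (hi a) * Kh_ q a.
  by rewrite mulrA Kh_KC -[LHS]mulrA Kh_KC mulrA.
by rewrite -Kh_KK_hi expr2 [LHS]mulrA -KKC -[LHS]mulrA -KKC.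
Qed.

Lemma KK_lo_KhV2 a i : K_ q (lo a) * K_ q i * KhV_ q a ^+ 2 =
  KhV_ q a * (K_ q (hi a) * K_ q i).
Proof.
have KKC : KhV_ q a * (K_ q (lo a) * K_ q i) = K_ q (lo a) * K_ q i * KhV_ q a.
  by rewrite mulrA KhV_KC -[LHS]mulrA KhV_KC mulrA.
by rewrite -KhV_KK_lo expr2 [LHS]mulrA -KKC -[LHS]mulrA -KKC.
Qed.

(** The corrections move the row index from [hi a] to [lo a] and the column index from [lo a] to
    [hi a]. The cases are the order of k and i, refined by their positions relative to a. *)
Lemma Lup_mul_e a k i :
  Lup k i * e_ q a =
  qhalf q (- (root_pairing a k + root_pairing a i)) *: (e_ q a * Lup k i)
  - ((k == hi a)%:R * qC q * qhalf q (- root_pairing a i)) *: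
      (KhV_ q a * Lup (lo a) i)
  + ((i == lo a)%:R * qhalf q (- root_pairing a k)) *: (Kh_ q a * Lup k (hi a)).
Proof.
have p0 := qhalf_neq0 hq 1; have pq := qhalf1_sqr hq.
(* The exponent is opposite to that of the statement; this does no harm where [far] is applied,
   because the two pairings add up to zero there. *)
have far : GRing.comm (e_ q a) (Eij q k i) -> (k < i)%N ->
    Lup k i * e_ q a =
    qhalf q (root_pairing a k + root_pairing a i) *: (e_ q a * Lup k i).
  move=> eE ki; rewrite (Lup_lt_mul (c := 1) (y := 0) ki (KK_e a k i)).
    by rewrite mulr0 scaler0 addr0 mulr1.
  by rewrite eE scale1r addr0.
have diag : k = i -> Lup k i * e_ q a =
    qhalf q (root_pairing a k + root_pairing a i) *: (e_ q a * Lup k i).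
  by move=> <-; rewrite Lup_diag expr2; apply: KK_e.
have zero : (i < k)%N -> Lup k i * e_ q a = 0.
  by move=> ik; rewrite Lup_gt // mul0r.
case: (ltngtP k i) => [ki|ik|/val_inj kiE].
- have near c y := @Lup_lt_mul k i c _ _ y ki (KK_e a k i).
  move: far near {zero diag} => /(_ _ ki).
  case: (positionP a k) => [ka|kE|kE|ka]; case: (positionP a i) => [ia|iE|iE|ia];
    try (exfalso; move: ki; rewrite ?kE ?iE /=; try move: ka; try move: ia;
         rewrite ?kE ?iE /=; lia);
    rewrite ?mul0r ?scale0r ?subr0 ?addr0 ?opprD ?oppr0 ?opprK ?add0r ?mul1r
            ?qhalfD ?qhalfN ?qhalf0 ?invr1 ?mulr1 => // far near.
  + by apply: far; apply: e_Eij_comm => //; rewrite ia orbT.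
  + rewrite {}iE in ki near *.
    (* The definition of [Eij q k (hi a)] as a bracket, read as an exchange relation. *)
    rewrite (near (qC q)^-1 (Eij q k (hi a))); last first.
      rewrite (@Eij_lt_bracket _ _ _ k (lo a) (hi a)) // Eij_e.
      by rewrite /qbracket addrC subrK.
    rewrite (@Lup_lt k (hi a)) ?ltn_lo_hi // -scalerAr [Kh_ q a * _]mulrA Kh_KK_hi.
    by rewrite scale1r; congr (_ *: _ + _); rewrite -pq; field.
  + rewrite {}iE in ki near *.
    rewrite (near (qC q) 0); last by rewrite addr0; apply: Eij_e_hi.
    rewrite mulr0 scaler0 addr0; congr (_ *: _).
    by rewrite -pq; field.
  + by apply: far; apply: e_Eij_inside.
  + rewrite far ?mulfV ?mulVf //.
    by rewrite kE iE Eij_e.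
  + rewrite {}kE in ki near *.
    rewrite (near (qC q)^-1 0); last first.
      by rewrite addr0 (e_Eij_lo hq ia) scalerA mulVf // scale1r.
    rewrite mulr0 scaler0 addr0; congr (_ *: _).
    by rewrite -pq; field.
  + rewrite {}kE in ki near *.
    (* The bracket defining [Eij q (lo a) i], solved for the product with [e_a] on the right. *)
    rewrite (near (qC q) (- (qC q *: Eij q (lo a) i))); last first.
      rewrite (@Eij_lt_bracket _ _ _ (lo a) (hi a) i) // Eij_e /qbracket.
      by alg_field (R[i]).
    rewrite (@Lup_lt (lo a) i) ?ltn_hi_lo // -[KhV_ q a * _]scalerAr.
    rewrite [KhV_ q a * _]mulrA KhV_KK_lo.
    rewrite [_ * - _]mulrN -[_ * (_ *: _)]scalerAr scalerN !scalerA.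
    congr (_ *: _ - _ *: _); last by rewrite mulrC.
    by rewrite -pq; field.
  + by apply: far; apply: e_Eij_comm => //; rewrite ka.
- rewrite zero // [Lup k i]Lup_gt // mulr0 scaler0 add0r.
  case: (positionP a k) => [ka|kE|kE|ka]; case: (positionP a i) => [ia|iE|iE|ia];
    try (exfalso; move: ik; rewrite ?kE ?iE /=; try move: ka; try move: ia;
         rewrite ?kE ?iE /=; lia);
    rewrite ?mul0r ?scale0r ?subr0 ?addr0 ?oppr0 ?opprK ?add0r ?mul1r //.
  + by rewrite Lup_gt ?mulr0 ?scaler0 ?oppr0.
  (* Below the diagonal only this case has nonzero corrections: both reach a diagonal entry, equal
     the same multiple of [K_ q (lo a) * K_ q (hi a)], and cancel. *)
  + rewrite kE iE !Lup_diag !expr2 !mulrA KhV_K_lo Kh_K_hi K_K -pq qhalfN.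
    by apply/esym/eqP; rewrite addrC subr_eq0; apply/eqP; congr (_ *: _); field.
  + by rewrite Lup_gt ?mulr0 ?scaler0.
- rewrite diag // kiE => {far zero diag}.
  case: (positionP a i) => [ia|->|->|ia];
    rewrite ?mul0r ?scale0r ?subr0 ?addr0 ?mul1r ?mulN1r ?opprK ?oppr0 //.
  (* Passing [e_a] through [K^2] gives q where the statement has q^-1; the factor q - q^-1 in
     [Lcoef] makes up the difference. *)
  + rewrite (@Lup_lt (lo a) (hi a)) // Lup_diag Eij_e -[Kh_ q a * _]scalerAr.
    rewrite [Kh_ q a * _]mulrA Kh_KK_hi.
    have := KK_e a (lo a) (lo a); rewrite root_pairing_at_lo -expr2 => ->.
    rewrite !scalerA -scalerDl; congr (_ *: _).
    by rewrite /Lcoef !(opprD, qhalfD) // qhalfN -pq; field.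
  + rewrite (@Lup_lt (lo a) (hi a)) // Lup_diag Eij_e -[KhV_ q a * _]scalerAr.
    rewrite [KhV_ q a * _]mulrA KhV_KK_lo.
    have := KK_e a (hi a) (hi a); rewrite root_pairing_at_hi -expr2 => ->.
    rewrite !scalerA -scalerBl; congr (_ *: _).
    by rewrite /Lcoef !(opprD, opprK, qhalfD) // qhalfN -pq; field.
Qed.

(** The corrections move the indices the opposite way to those for [e_a]. They come from the Cartan
    part of the commutator of [e_a] and [f_a], so they arise only above the diagonal. *)
Lemma Lup_mul_f a k i :
  Lup k i * f_ q a =
  qhalf q (- (root_pairing a k + root_pairing a i)) *: (f_ q a * Lup k i)
  - ((k == lo a)%:R * (qC q)^-1 * qhalf q (- root_pairing a i)) *:
      (KhV_ q a * Lup (hi a) i)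
  + ((i == hi a)%:R * qhalf q (- root_pairing a k)) *: (Kh_ q a * Lup k (lo a)).
Proof.
have p0 := qhalf_neq0 hq 1; have pq := qhalf1_sqr hq.
case: (ltngtP k i) => [ki|ik|/val_inj kiE].
- have near y := @Lup_lt_mul k i 1 _ _ y ki (KK_f a k i).
  have far : GRing.comm (f_ q a) (Eij q k i) -> Lup k i * f_ q a =
      qhalf q (- (root_pairing a k + root_pairing a i)) *: (f_ q a * Lup k i).
    move=> fE; rewrite (near 0); first by rewrite mulr0 scaler0 addr0 mulr1.
    by rewrite fE scale1r addr0.
  move: far near.
  case: (positionP a k) => [ka|kE|kE|ka]; case: (positionP a i) => [ia|iE|iE|ia];
    try (exfalso; move: ki; rewrite ?kE ?iE /=; try move: ka; try move: ia;
         rewrite ?kE ?iE /=; lia);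
    rewrite ?mul0r ?scale0r ?subr0 ?addr0 ?opprD ?oppr0 ?opprK ?add0r ?mul1r
            ?qhalfD ?qhalfN ?qhalf0 ?invr1 ?mulr1 => // far near.
  + by apply: far; apply: f_Eij_comm => //; rewrite (ltnW ia) orbT.
  + by apply: far; apply: f_Eij_comm => //; rewrite iE leqnn orbT.
  + rewrite {}iE in ki near *.
    rewrite (near (Kh_ q a ^+ 2 * Eij q k (lo a))); last first.
      by rewrite scale1r; apply: Eij_hi_f.
    rewrite (@Lup_lt k (lo a)) // -[Kh_ q a * _]scalerAr scale1r.
    by rewrite [K_ q k * _ * _]mulrA KK_hi_Kh2 -mulrA.
  + by apply: far; apply: f_Eij_inside.
  (* Here the root vector is [e_a] itself: [Lcoef] cancels the denominator of the commutator, and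
     its two halves become the two diagonal entries. *)
  + rewrite {}iE {}kE in near *.
    rewrite (near ((qC q - (qC q)^-1)^-1 *: (Kh_ q a ^+ 2 - KhV_ q a ^+ 2))); last first.
      by rewrite Eij_e scale1r -e_f_comm addrC subrK.
    rewrite !Lup_diag -!addrA; congr (_ *: _ + _); first by rewrite mulVf.
    rewrite -[_ * _ * _]scalerAr mulrBr KK_hi_Kh2 KK_lo_KhV2 -!expr2 scalerA.
    rewrite scalerBr addrC; congr (_ *: _ - _ *: _).
      by rewrite /Lcoef mulrAC mulfV // mul1r qhalfN.
    by rewrite /Lcoef mulrAC mulfV // mul1r qhalfN -pq; field.
  + rewrite {}kE in ki near *.
    rewrite (near (- ((qC q)^-1 *: (KhV_ q a ^+ 2 * Eij q (hi a) i)))); last first.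
      by rewrite scale1r; apply: Eij_lo_f.
    rewrite (@Lup_lt (hi a) i) // -[KhV_ q a * _]scalerAr.
    rewrite [_ * - _]mulrN -[_ * (_ *: _)]scalerAr [K_ q (lo a) * _ * _]mulrA.
    rewrite KK_lo_KhV2 -[KhV_ q a * _ * _]mulrA scalerN !scalerA.
    by congr (_ - _ *: _); rewrite mulrC.
  + by apply: far; apply: f_Eij_comm => //; rewrite kE ltnSn.
  + by apply: far; apply: f_Eij_comm => //; rewrite (ltn_trans _ ka).
- rewrite [Lup k i]Lup_gt // mul0r mulr0 scaler0 add0r.
  case: (positionP a k) => [ka|kE|kE|ka]; case: (positionP a i) => [ia|iE|iE|ia];
    try (exfalso; move: ik; rewrite ?kE ?iE /=; try move: ka; try move: ia;
         rewrite ?kE ?iE /=; lia);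
    rewrite ?mul0r ?scale0r ?subr0 ?addr0 ?oppr0 ?opprK ?add0r ?mul1r //.
  + by rewrite Lup_gt ?ltn_lo_hi // mulr0 scaler0 oppr0.
  + by rewrite Lup_gt ?ltn_hi_lo // mulr0 scaler0.
- rewrite kiE Lup_diag expr2 (KK_f a i i) -expr2.
  case: (positionP a i) => [ia|->|->|ia];
    rewrite ?mul0r ?scale0r ?subr0 ?addr0 //.
  + by rewrite Lup_gt // mulr0 scaler0 subr0.
  + by rewrite Lup_gt // mulr0 scaler0 addr0.
Qed.

End UpperMatrix.

(** * The anti-involution theta *)

Section Flip.
Context {R : realType} {q : R} {n : nat}.
Hypothesis hq : 0 < q.
Notation U := (Uq q n).
Notation C := R[i].

Definition flip_gen (x : generator n) : opposite U :=
  match x with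
  | Ge i => f_ q i | Gf i => e_ q i | GK a => K_ q a | GKV a => KV_ q a
  end.

Lemma KV_e_K a j : KV_ q a * e_ q j * K_ q a = qhalf q (- root_pairing j a) *: e_ q j :> U.
Proof.
rewrite -mulrA qhalfN; apply: (canRL (scalerK (qhalf_neq0 hq _))).
by rewrite scalerAr scalerAl -K_e -[_ * KV_ q a * _]mulrA KV_K mulr1 mulrA KV_K mul1r.
Qed.

Lemma KV_f_K a j : KV_ q a * f_ q j * K_ q a = qhalf q (root_pairing j a) *: f_ q j :> U.
Proof.
rewrite -[root_pairing j a]opprK qhalfN -mulrA.
apply: (canRL (scalerK (qhalf_neq0 hq _))).
by rewrite scalerAr scalerAl -K_f -[_ * KV_ q a * _]mulrA KV_K mulr1 mulrA KV_K mul1r.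
Qed.

Lemma flip_gen_rel s t : Uq_rel q s t -> eval flip_gen s = eval flip_gen t.
Proof.
case=> {s t} /= => [k|k|k l|k j|k j|i j|i j ij|i j ij|i j ij|i j ij];
  rewrite ?mulr_algl !opmulE ?scaleN1r ?scale0r.
- by rewrite KV_K scale1r.
- by rewrite K_KV scale1r.
- exact: K_K.
- by rewrite mulrA KV_f_K.
- by rewrite mulrA KV_e_K.
(* Reversing products and exchanging e with f compensate, so this relation returns with i and j
   interchanged. *)
- rewrite e_f eq_sym; have [->|_] := eqVneq i j; last by rewrite !mul0r !scale0r.
  by rewrite /Kh_ /KhV_ !expr2 -!(K_KVC q).
- by apply: f_f; rewrite distnC.
- by apply: e_e; rewrite distnC.
- refine (etrans (_ : _ = _ :> U) (f_serre q ij)); by alg_field (R[i]).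
- refine (etrans (_ : _ = _ :> U) (e_serre q ij)); by alg_field (R[i]).
Qed.

Definition flip : U -> U := Uq_lift flip_gen_rel.

Lemma flip_linear : linear flip.
Proof. exact: (linearP (Uq_lift flip_gen_rel)). Qed.

HB.instance Definition _ := GRing.isLinear.Build C U U *:%R flip flip_linear.

Lemma flip1 : flip 1 = 1.
Proof. exact: (rmorph1 (Uq_lift flip_gen_rel)). Qed.

Lemma flipM x y : flip (x * y) = flip y * flip x.
Proof. exact: (rmorphM (Uq_lift flip_gen_rel) x y). Qed.

Lemma flip_e i : flip (e_ q i) = f_ q i.
Proof. exact: (Uq_lift_gen flip_gen_rel (Ge i)). Qed.

Lemma flip_f i : flip (f_ q i) = e_ q i.
Proof. exact: (Uq_lift_gen flip_gen_rel (Gf i)). Qed.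

Lemma flip_K a : flip (K_ q a) = K_ q a.
Proof. exact: (Uq_lift_gen flip_gen_rel (GK a)). Qed.

Lemma flip_KV a : flip (KV_ q a) = KV_ q a.
Proof. exact: (Uq_lift_gen flip_gen_rel (GKV a)). Qed.

Lemma flipK : involutive flip.
Proof.
apply: Uq_ind.
- by move=> i; rewrite flip_e flip_f.
- by move=> i; rewrite flip_f flip_e.
- by move=> a; rewrite !flip_K.
- by move=> a; rewrite !flip_KV.
- by move=> c; rewrite !linearZ /= !flip1.
- by move=> x y Hx Hy; rewrite !linearD /= Hx Hy.
- by move=> x y Hx Hy; rewrite !flipM Hx Hy.
Qed.

(** On generators: the scalar of S^-1 on [e_i] is that of S on [f_i], and conversely. *)
Lemma flip_antipodeV x : flip (antipodeV x) = antipode (flip x).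
Proof.
elim/(@Uq_ind _ q n): x.
- by move=> i; rewrite antipodeV_e flip_e antipode_f linearZ /= flip_e.
- by move=> i; rewrite antipodeV_f flip_f antipode_e linearZ /= flip_f.
- by move=> a; rewrite antipodeV_K flip_K flip_KV antipode_K.
- by move=> a; rewrite antipodeV_KV flip_KV flip_K antipode_KV.
- by move=> c; rewrite !linearZ /= antipodeV1 flip1 antipode1.
- by move=> x y Hx Hy; rewrite !linearD /= Hx Hy.
- by move=> x y Hx Hy; rewrite antipodeVM !flipM antipodeM Hx Hy.
Qed.

Lemma flip_Kh a : flip (Kh_ q a) = Kh_ q a.
Proof. by rewrite flipM flip_K flip_KV -K_KVC. Qed.

Lemma flip_KhV a : flip (KhV_ q a) = KhV_ q a.
Proof. by rewrite flipM flip_K flip_KV K_KVC. Qed.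

Lemma flip_bracket x y : flip (qbracket x y) = qbracket (flip y) (flip x).
Proof. by rewrite /qbracket linearB linearZ /= !flipM. Qed.

Lemma flip_e_nat m : flip (e_nat q n m) = f_nat q n m.
Proof.
by rewrite /e_nat /f_nat; case: insubP => [a _ _|_]; rewrite ?flip_e ?linear0.
Qed.

Lemma flip_E_up k d : flip (E_up q n k d) = E_down q n k d.
Proof. by elim: d => [|d IHd] /=; rewrite ?flip_bracket ?IHd flip_e_nat. Qed.

(** Reversal puts the Cartan prefactor on the other side of the root vector; it can be moved back
    because eps_k + eps_i is orthogonal to eps_k - eps_i. *)
Lemma flip_Ehat (k i : 'I_n) : (k <= i)%N -> flip (Ehat q k i) = Ehat q i k.
Proof.
rewrite leq_eqVlt => /orP[/eqP/val_inj<-|ki].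
  by rewrite /Ehat eqxx !expr2 flipM flip_K.
rewrite /Ehat (negPf (ord_ltn_neq ki)) eq_sym (negPf (ord_ltn_neq ki)).
rewrite linearZ /=; congr (_ *: _).
have KE : qcomm (qhalf q (weight k i k + weight k i i)) (K_ q k * K_ q i) (Eij q k i).
  by rewrite qhalfD //; apply: qcommMl; apply: K_mul_Eij.
rewrite KE linearZ /= !flipM !flip_K.
have -> : weight k i k + weight k i i = 0.
  by rewrite /weight !eqxx eq_sym; case: eqP; rewrite ?subrr // subr0 sub0r subrr.
by rewrite qhalf0 scale1r /Eij ki ltnNge ltnW //= flip_E_up.
Qed.

End Flip.

(** * Exchange relations for the matrix T *)

Section ReflectionMatrix.
Context {R : realType} {q : R} {n : nat}.
Hypothesis hq : 0 < q.
Hypothesis hq1 : q != 1.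
Notation U := (Uq q n).
Notation C := R[i].
Notation flip := (flip hq (n := n)).
Implicit Types (a : 'I_n.-1) (b i j k : 'I_n) (x y : U).

Let qC0 : qC q != 0. Proof. exact: qC_neq0. Qed.

(** The X_ki of the overview; [Tmx] below is its T. *)
Definition SLup k i : U := antipodeV (Lup k i).

Definition Tmx i j : U := \sum_k SLup k i * flip (SLup k j).

Lemma Atilde_Tmx i j :
  Atilde q i j = (qC q - (qC q)^-1)^-1 *: ((i == j)%:R - Tmx i j).
Proof.
congr (_ *: (_ - _)); rewrite big_mkcond /=; apply: eq_bigr => k _.
rewrite /SLup flip_antipodeV /Lup leq_min.
case: (leqP k i) => ki; last by rewrite linear0 mul0r.
case: (leqP k j) => kj; last by rewrite !linear0 mulr0.
by rewrite flip_Ehat.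
Qed.

Lemma flip_Tmx i j : flip (Tmx i j) = Tmx j i.
Proof.
by rewrite /Tmx linear_sum; apply: eq_bigr => k _ /=; rewrite flipM flipK.
Qed.

Lemma antipodeV_Kh a : antipodeV (Kh_ q a) = KhV_ q a.
Proof. by rewrite antipodeVM antipodeV_K antipodeV_KV K_KVC. Qed.

Lemma antipodeV_KhV a : antipodeV (KhV_ q a) = Kh_ q a.
Proof. by rewrite antipodeVM antipodeV_K antipodeV_KV -K_KVC. Qed.

(** S^-1 applied to [Lup_mul_e] reverses all products and so moves [e_a] to the left; the scalar
    -q^-1 undoes S^-1 on [e_a]. *)
Lemma e_mul_SLup a k i :
  e_ q a * SLup k i =
  qhalf q (- (root_pairing a k + root_pairing a i)) *: (SLup k i * e_ q a)
  + ((k == hi a)%:R * qhalf q (- root_pairing a i)) *: (SLup (lo a) i * Kh_ q a)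
  - ((i == lo a)%:R * (qC q)^-1 * qhalf q (- root_pairing a k)) *:
      (SLup k (hi a) * KhV_ q a).
Proof.
have := congr1 (fun x => - (qC q)^-1 *: antipodeV x) (Lup_mul_e hq hq1 a k i).
rewrite linearD linearB !linearZ /=.
rewrite [antipodeV (e_ q a * _)]antipodeVM [antipodeV (_ * e_ q a)]antipodeVM.
rewrite [antipodeV (Kh_ q a * _)]antipodeVM [antipodeV (KhV_ q a * _)]antipodeVM.
rewrite antipodeV_e antipodeV_Kh antipodeV_KhV -!/(SLup _ _) => eS.
have -> : e_ q a * SLup k i = - (qC q)^-1 *: (- qC q *: e_ q a * SLup k i).
  by alg_field (R[i]).
by rewrite eS; alg_field (R[i]).
Qed.

Lemma f_mul_SLup a k i :
  f_ q a * SLup k i =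
  qhalf q (- (root_pairing a k + root_pairing a i)) *: (SLup k i * f_ q a)
  + ((k == lo a)%:R * qhalf q (- root_pairing a i)) *: (SLup (hi a) i * Kh_ q a)
  - ((i == hi a)%:R * qC q * qhalf q (- root_pairing a k)) *:
      (SLup k (lo a) * KhV_ q a).
Proof.
have := congr1 (fun x => - qC q *: antipodeV x) (Lup_mul_f hq hq1 a k i).
rewrite linearD linearB !linearZ /=.
rewrite [antipodeV (f_ q a * _)]antipodeVM [antipodeV (_ * f_ q a)]antipodeVM.
rewrite [antipodeV (Kh_ q a * _)]antipodeVM [antipodeV (KhV_ q a * _)]antipodeVM.
rewrite antipodeV_f antipodeV_Kh antipodeV_KhV -!/(SLup _ _) => fS.
have -> : f_ q a * SLup k i = - qC q *: (- (qC q)^-1 *: f_ q a * SLup k i).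
  by alg_field (R[i]).
by rewrite fS; alg_field (R[i]).
Qed.

Lemma K_mul_Lup b k i : qcomm (qhalf q (weight k i b)) (K_ q b) (Lup k i).
Proof.
have KK l : qcomm 1 (K_ q b) (K_ q l) by rewrite /qcomm scale1r K_K.
case: (ltngtP k i) => [ki|ik|/val_inj <-].
- rewrite Lup_lt //; apply: qcommZr; rewrite -[qhalf q _]mul1r.
  apply: qcommMr; last exact: K_mul_Eij.
  by rewrite -[1]mulr1; apply: qcommMr.
- by rewrite Lup_gt // /qcomm mulr0 mul0r scaler0.
- rewrite Lup_diag /weight subrr qhalf0 -[1]mulr1 expr2; exact: qcommMr.
Qed.

Lemma K_mul_SLup b k i : qcomm (qhalf q (weight k i b)) (K_ q b) (SLup k i).
Proof.
have := congr1 (@antipodeV _ q n) (K_mul_Lup b k i).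
rewrite linearZ /= !antipodeVM antipodeV_K -/(SLup k i) => SK.
rewrite /qcomm -[LHS]mulr1 -(KV_K q b) mulrA -[K_ q b * _ * _]mulrA SK.
by rewrite -scalerAr -scalerAl mulrA K_KV mul1r.
Qed.

Lemma Kh_mul_SLup a k i :
  qcomm (qhalf q (root_pairing a k - root_pairing a i)) (Kh_ q a) (SLup k i).
Proof.
have -> : root_pairing a k - root_pairing a i =
    weight k i (lo a) - weight k i (hi a).
  by rewrite /root_pairing /weight; ring.
rewrite qhalfD // qhalfN.
apply: Kh_mul_qcomm; rewrite ?qhalf_neq0 //; exact: K_mul_SLup.
Qed.

(** Verifies the last hypothesis of [mul_sum_intertwine]. *)
Lemma KhV_mul_flip_SLup a k j : root_pairing a j = 0 ->
  qhalf q (- root_pairing a k) *: (KhV_ q a * flip (SLup k j)) =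
  flip (SLup k j) * KhV_ q a.
Proof.
move=> aj; have := congr1 flip (Kh_mul_SLup a k j).
rewrite linearZ /= [flip (Kh_ q a * _)]flipM [flip (_ * Kh_ q a)]flipM.
rewrite flip_Kh aj subr0 => YK.
rewrite -[RHS]mul1r -(KhV_Kh a) -mulrA [Kh_ q a * _]mulrA.
have -> : Kh_ q a * flip (SLup k j) =
    qhalf q (- root_pairing a k) *: (flip (SLup k j) * Kh_ q a).
  by rewrite YK scalerA qhalfN mulVf ?qhalf_neq0 // scale1r.
by rewrite -!scalerAl -scalerAr -[_ * Kh_ q a * _]mulrA Kh_KhV mulr1.
Qed.

(* The hypotheses on X and Y are the relations satisfied, with {s, t} = {lo a,
   hi a}, by SLup and its image under flip; the terms at k = s and k = t that
   arise from the inner index cancel in the sum. *)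
Lemma mul_sum_intertwine (s t : 'I_n) (X X' Y : 'I_n -> U) (alpha : 'I_n -> C)
    (beta c : C) (g h h' : U) :
  (forall k, g * X k = (alpha k * beta) *: (X k * g)
     + ((k == t)%:R * beta) *: (X s * h) - (c * alpha k) *: (X' k * h')) ->
  (forall k, Y k * g = alpha k *: (g * Y k) + (k == s)%:R *: (h * Y t)) ->
  (forall k, alpha k *: (h' * Y k) = Y k * h') ->
  g * (\sum_k X k * Y k) =
  beta *: ((\sum_k X k * Y k) * g) - c *: ((\sum_k X' k * Y k) * h').
Proof.
move=> gX Yg h'Y; have pick (u : 'I_n) z : \sum_k (k == u)%:R *: z = z :> U.
  rewrite (bigD1 u) //= eqxx scale1r big1 ?addr0 // => k /negPf->.
  by rewrite scale0r.
rewrite !(mulr_sumr, mulr_suml, scaler_sumr) -sumrB.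
transitivity (\sum_k (beta *: (X k * Y k * g) - c *: (X' k * Y k * h')
   + beta *: ((k == t)%:R *: (X s * h * Y t) - (k == s)%:R *: (X s * h * Y t)))).
  apply: eq_bigr => k _; rewrite -[X' k * _ * _]mulrA -h'Y -[X k * _ * g]mulrA Yg.
  rewrite [g * _]mulrA gX.
  (* The Kronecker factors allow a fixed index to be replaced by [k], after which both sides agree
     monomial by monomial. *)
  have -> : (k == t)%:R *: (X s * h * Y t) = (k == t)%:R *: (X s * h * Y k).
    by case: eqP => [->//|_]; rewrite !scale0r.
  have -> : (k == s)%:R *: (X s * h * Y t) = (k == s)%:R *: (X k * h * Y t).
    by case: eqP => [->//|_]; rewrite !scale0r.
  by alg_field (R[i]).
rewrite big_split /= [X in _ + X](_ : _ = 0) ?addr0 //.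
by rewrite -scaler_sumr sumrB !pick subrr scaler0.
Qed.

(** The second factor obeys the flip of [f_mul_SLup]; as j is neither [lo a] nor [hi a], its column
    correction and the power of q from j disappear. *)
Lemma e_mul_Tmx a i j : j != lo a -> j != hi a ->
  e_ q a * Tmx i j = qhalf q (- root_pairing a i) *: (Tmx i j * e_ q a)
    - ((i == lo a)%:R * (qC q)^-1) *: (Tmx (hi a) j * KhV_ q a).
Proof.
move=> jl jh; have aj := root_pairing_neq jl jh.
apply: (@mul_sum_intertwine (lo a) (hi a) _ (SLup^~ (hi a)) _
  (fun k => qhalf q (- root_pairing a k)) _ _ _ (Kh_ q a)) => k.
- by rewrite e_mul_SLup opprD qhalfD.
- have := congr1 flip (f_mul_SLup a k j).
  rewrite linearB linearD !linearZ /=.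
  rewrite [flip (f_ q a * _)]flipM [flip (_ * f_ q a)]flipM [flip (_ * Kh_ q a)]flipM.
  rewrite flip_f flip_Kh => ->.
  by rewrite aj (negPf jh) oppr0 qhalf0 mulr1 !mul0r scale0r !addr0.
- exact: KhV_mul_flip_SLup.
Qed.

Lemma f_mul_Tmx a i j : j != lo a -> j != hi a ->
  f_ q a * Tmx i j = qhalf q (- root_pairing a i) *: (Tmx i j * f_ q a)
    - ((i == hi a)%:R * qC q) *: (Tmx (lo a) j * KhV_ q a).
Proof.
move=> jl jh; have aj := root_pairing_neq jl jh.
apply: (@mul_sum_intertwine (hi a) (lo a) _ (SLup^~ (lo a)) _
  (fun k => qhalf q (- root_pairing a k)) _ _ _ (Kh_ q a)) => k.
- by rewrite f_mul_SLup opprD qhalfD.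
- have := congr1 flip (e_mul_SLup a k j).
  rewrite linearB linearD !linearZ /=.
  rewrite [flip (e_ q a * _)]flipM [flip (_ * e_ q a)]flipM [flip (_ * Kh_ q a)]flipM.
  rewrite flip_e flip_Kh => ->.
  by rewrite aj (negPf jl) oppr0 qhalf0 mulr1 !mul0r scale0r !addr0.
- exact: KhV_mul_flip_SLup.
Qed.

(** The summation index contributes opposite weights to the two factors. *)
Lemma K_mul_Tmx b i j : qcomm (qhalf q (weight j i b)) (K_ q b) (Tmx i j).
Proof.
rewrite /qcomm /Tmx mulr_sumr mulr_suml scaler_sumr; apply: eq_bigr => k _.
have := congr1 flip (K_mul_SLup b k j).
rewrite linearZ /= !flipM flip_K => YK.
rewrite mulrA K_mul_SLup -scalerAl -[SLup k i * K_ q b * _]mulrA.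
rewrite -[SLup k i * _ * K_ q b]mulrA YK.
rewrite -scalerAr scalerA -qhalfD //; congr (qhalf q _ *: _).
by rewrite /weight; ring.
Qed.

Lemma KhV_mul_Tmx a i j :
  qcomm (qhalf q (root_pairing a i - root_pairing a j)) (KhV_ q a) (Tmx i j).
Proof.
have -> : root_pairing a i - root_pairing a j =
    - (weight j i (lo a) - weight j i (hi a)).
  by rewrite /root_pairing /weight; ring.
rewrite qhalfN; apply: qcommVl (KhV_Kh _) (Kh_KhV _) _; first exact: qhalf_neq0.
rewrite qhalfD // qhalfN.
apply: Kh_mul_qcomm; rewrite ?qhalf_neq0 //; exact: K_mul_Tmx.
Qed.

(** The flip of [f_mul_Tmx] has [e_a] on the right of T_ij. Solving for [e_a] on the left gives one
    factor q^(1/2) and moving [KhV] to the right another, q^(-1/2), so the correction has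
    coefficient 1. *)
Lemma e_mul_Tmx_row a i j : i != lo a -> i != hi a ->
  e_ q a * Tmx i j = qhalf q (root_pairing a j) *: (Tmx i j * e_ q a)
    + (j == hi a)%:R *: (Tmx i (lo a) * KhV_ q a).
Proof.
move=> il ih; have p0 := qhalf_neq0 hq 1; have pq := qhalf1_sqr hq.
have := congr1 flip (f_mul_Tmx j il ih).
rewrite linearB /= ![flip (_ *: _)]linearZ /=.
rewrite [flip (f_ q a * _)]flipM [flip (_ * f_ q a)]flipM.
rewrite [flip (_ * KhV_ q a)]flipM flip_f flip_KhV !flip_Tmx => ->.
have := KhV_mul_Tmx a i (lo a).
rewrite (root_pairing_neq il ih) root_pairing_at_lo sub0r => ->.
have [->|_] := eqVneq j (hi a).
  rewrite root_pairing_at_hi opprK qhalfN -pq; alg_field (R[i]).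
rewrite ?mul0r !scale0r qhalfN; have w0 := qhalf_neq0 hq (root_pairing a j).
by alg_field (R[i]).
Qed.

Lemma f_mul_Tmx_row a i j : i != lo a -> i != hi a ->
  f_ q a * Tmx i j = qhalf q (root_pairing a j) *: (Tmx i j * f_ q a)
    + (j == lo a)%:R *: (Tmx i (hi a) * KhV_ q a).
Proof.
move=> il ih; have p0 := qhalf_neq0 hq 1; have pq := qhalf1_sqr hq.
have := congr1 flip (e_mul_Tmx j il ih).
rewrite linearB /= ![flip (_ *: _)]linearZ /=.
rewrite [flip (e_ q a * _)]flipM [flip (_ * e_ q a)]flipM.
rewrite [flip (_ * KhV_ q a)]flipM flip_e flip_KhV !flip_Tmx => ->.
have := KhV_mul_Tmx a i (hi a).
rewrite (root_pairing_neq il ih) root_pairing_at_hi sub0r opprK => ->.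
have [->|_] := eqVneq j (lo a).
  rewrite root_pairing_at_lo !qhalfN -pq; alg_field (R[i]).
rewrite ?mul0r !scale0r qhalfN; have w0 := qhalf_neq0 hq (root_pairing a j).
by alg_field (R[i]).
Qed.

End ReflectionMatrix.

(** * Compatibility of the constructions with the inclusion of U_q(n-1) *)

Section InclusionCompatibility.
Context {R : realType} {q : R} {n : nat}.
Notation C := R[i].
Notation incl := (incl q n).

Lemma incl_antipode x : incl (antipode x) = antipode (incl x).
Proof.
elim/(@Uq_ind _ q n.-1): x => [i|i|a|a|c|x y Hx Hy|x y Hx Hy].
- by rewrite antipode_e linearZ /= incl_e antipode_e.
- by rewrite antipode_f linearZ /= incl_f antipode_f.
- by rewrite antipode_K incl_KV incl_K antipode_K.
- by rewrite antipode_KV incl_KV incl_K antipode_KV.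
- by rewrite !linearZ /= antipode1 rmorph1 antipode1.
- by rewrite !linearD /= Hx Hy.
- by rewrite antipodeM !rmorphM /= antipodeM Hx Hy.
Qed.

Lemma incl_antipodeV x : incl (antipodeV x) = antipodeV (incl x).
Proof.
elim/(@Uq_ind _ q n.-1): x => [i|i|a|a|c|x y Hx Hy|x y Hx Hy].
- by rewrite antipodeV_e linearZ /= incl_e antipodeV_e.
- by rewrite antipodeV_f linearZ /= incl_f antipodeV_f.
- by rewrite antipodeV_K incl_KV incl_K antipodeV_K.
- by rewrite antipodeV_KV incl_KV incl_K antipodeV_KV.
- by rewrite !linearZ /= antipodeV1 rmorph1 antipodeV1.
- by rewrite !linearD /= Hx Hy.
- by rewrite antipodeVM !rmorphM /= antipodeVM Hx Hy.
Qed.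

(** The bound matters: at m = n-2 the left side is the default 0, whereas U_q(n) has a generator
    with that index. *)
Lemma incl_e_nat m : (m < n.-2)%N -> incl (e_nat q n.-1 m) = e_nat q n m.
Proof.
by move=> mn; rewrite {1}/e_nat insubT /= incl_e -e_nat_val.
Qed.

Lemma incl_f_nat m : (m < n.-2)%N -> incl (f_nat q n.-1 m) = f_nat q n m.
Proof.
move=> mn; rewrite {1}/f_nat insubT /= incl_f.
by rewrite /f_nat -[m in RHS]/(val (lo (Ordinal mn))) valK.
Qed.

Lemma incl_bracket x y : incl (qbracket x y) = qbracket (incl x) (incl y).
Proof. by rewrite /qbracket linearB linearZ /= !rmorphM. Qed.

Lemma incl_E_up k d : (k + d < n.-2)%N -> incl (E_up q n.-1 k d) = E_up q n k d.
Proof.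
elim: d => [|d IHd] kd /=; first by apply: incl_e_nat; lia.
by rewrite incl_bracket IHd ?incl_e_nat //; lia.
Qed.

Lemma incl_E_down k d :
  (k + d < n.-2)%N -> incl (E_down q n.-1 k d) = E_down q n k d.
Proof.
elim: d => [|d IHd] kd /=; first by apply: incl_f_nat; lia.
by rewrite incl_bracket IHd ?incl_f_nat //; lia.
Qed.

Lemma incl_Eij (i j : 'I_n.-1) : incl (Eij q i j) = Eij q (lo i) (lo j).
Proof.
have := ltn_ord i; have := ltn_ord j; rewrite /Eij /= => jn ln.
case: ltnP => [ij|_]; first by apply: incl_E_up; lia.
by case: ltnP => [ji|_]; [apply: incl_E_down; lia | rewrite linear0].
Qed.

Lemma incl_Ehat (i j : 'I_n.-1) : incl (Ehat q i j) = Ehat q (lo i) (lo j).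
Proof.
rewrite /Ehat (inj_eq (@lo_inj n)); case: eqP => _; first by rewrite rmorphXn /= incl_K.
by rewrite linearZ /= !rmorphM /= !incl_K incl_Eij.
Qed.

Lemma incl_KhV (i : 'I_n.-2) : incl (KhV_ q i) = KhV_ q (lo i).
Proof. by rewrite /KhV_ rmorphM /= incl_KV incl_K lo_hi. Qed.

Lemma sum_lo (V : nmodType) (P : pred 'I_n) (F : 'I_n -> V) :
  (forall k, P k -> k < n.-1)%N -> \sum_(k | P k) F k = \sum_(k | P (lo k)) F (lo k).
Proof.
case: n P F => [|m] P F Pm; first by rewrite !big_ord0.
rewrite big_mkcond big_ord_recr /= ifF; last by apply/negP => /Pm; rewrite ltnn.
rewrite addr0 [RHS]big_mkcond; apply: eq_bigr => k _.
by rewrite (_ : widen_ord _ k = @lo m.+1 k) //; apply: val_inj.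
Qed.

(** The summation index is at most min(i, j), so it never reaches the last index and both sums have
    the same range. *)
Lemma Atilde_incl (i j : 'I_n.-1) :
  Atilde q (lo i) (lo j) = incl (Atilde q i j).
Proof.
rewrite /Atilde linearZ /= [incl (_ - _)]linearB /= rmorph_nat.
rewrite [incl (\sum_(k | _) _)]linear_sum /=.
rewrite (inj_eq (@lo_inj n)) sum_lo; last first.
  by move=> k; rewrite leq_min => /andP[/leq_ltn_trans-> //=].
congr (_ *: (_ - _)); apply: eq_big => // k _.
by rewrite rmorphM /= incl_antipode incl_antipodeV !incl_Ehat.
Qed.

End InclusionCompatibility.

(** * The four assertions *)

Lemma qhalf_sqr (R : realType) (q : R) (hq : 0 < q) (z : int) :
  qhalf q z ^+ 2 = qC q ^ z.
Proof. by rewrite -(qhalf1_sqr hq) /qhalf expr1z !exprnP exprzAC. Qed.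

Theorem mainTheorem2 (R : realType) (q : R) (hq : 0 < q) (hq1 : q != 1)
    (n : nat) (hn : (1 < n)%N) :
  [/\ forall i j : 'I_n.-1,
        Atilde q (lo i) (lo j) = incl q n (Atilde q i j),
      forall x : Uq q n.-1,
        Atilde q (last_index hn) (last_index hn) * incl q n x =
        incl q n x * Atilde q (last_index hn) (last_index hn),
      dual_vector_operator (incl q n)
        (fun i : 'I_n.-1 => Atilde q (lo i) (last_index hn)) &
      vector_operator (incl q n)
        (fun i : 'I_n.-1 => Atilde q (last_index hn) (lo i))].
Proof.
set l := last_index hn.
(* The simple roots of U_q(n-1) do not involve the last index, so the relations of [Tmx] apply to
   the last column and to the last row. *)
have nlo (i : 'I_n.-1) : lo i != l by rewrite -val_eqE /= ltn_eqF.
have nhi (i : 'I_n.-2) : hi (lo i) != l by rewrite -lo_hi nlo.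
have lnlo (i : 'I_n.-1) : l != lo i by rewrite eq_sym.
have lnhi (i : 'I_n.-2) : l != hi (lo i) by rewrite eq_sym.
have rpl (i : 'I_n.-2) : root_pairing (lo i) l = 0 by exact: root_pairing_neq.
split=> [i j|x||].
- exact: Atilde_incl.
(* The identity part is central, so it remains to commute T_nn with the generators; every correction
   vanishes at the last index. *)
- rewrite Atilde_Tmx eqxx -scalerAl -scalerAr mulrBl mulrBr mul1r mulr1.
  congr (_ *: (_ - _)).
  elim/(@Uq_ind _ q n.-1): x => [i|i|a|a|c|x y Hx Hy|x y Hx Hy].
  + rewrite incl_e e_mul_Tmx // rpl qhalfN qhalf0 invr1 scale1r.
    by rewrite (negPf (lnlo _)) mul0r scale0r subr0.
  + rewrite incl_f f_mul_Tmx // rpl qhalfN qhalf0 invr1 scale1r.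
    by rewrite (negPf (lnhi _)) mul0r scale0r subr0.
  + by rewrite incl_K K_mul_Tmx // /weight subrr qhalf0 scale1r.
  + rewrite incl_KV; have := K_mul_Tmx hq (lo a) l l.
    rewrite /weight subrr qhalf0 => KT; apply/esym/qcomm1; rewrite -[1]invr1.
    exact: qcommVl (oner_neq0 _) (KV_K _ _) (K_KV _ _) KT.
  + by rewrite linearZ /= rmorph1 -scalerAr -scalerAl mulr1 mul1r.
  + by rewrite linearD /= mulrDl mulrDr Hx Hy.
  + by rewrite rmorphM /= mulrA Hx -mulrA Hy mulrA.
- have E k : Atilde q (lo k) l = - (qC q - (qC q)^-1)^-1 *: Tmx hq (lo k) l.
    by rewrite (Atilde_Tmx hq) (negPf (nlo k)) sub0r scalerN scaleNr.
  split=> [i k|i k|i k]; rewrite !E; set c := - _^-1.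
  + rewrite rmorphXn /= incl_K -!scalerAr -!scalerAl.
    (* Squaring passes from q^(E_ii/2) to q^(E_ii) and turns the half power of q into a whole
       one. *)
    have /qcomm_sqr -> := K_mul_Tmx hq (lo i) (lo k) l.
    rewrite /weight (negPf (lnlo _)) (inj_eq (@lo_inj n)) sub0r (eq_sym k).
    by rewrite qhalf_sqr // !scalerA mulrC.
  + rewrite incl_e incl_KhV -root_pairing_lo lo_hi -(inj_eq (@lo_inj n)).
    by rewrite -scalerAr e_mul_Tmx //; alg_field (R[i]).
  + rewrite incl_f incl_KhV -root_pairing_lo -(inj_eq (@lo_inj n)) lo_hi.
    by rewrite -scalerAr f_mul_Tmx //; alg_field (R[i]).
- have E k : Atilde q l (lo k) = - (qC q - (qC q)^-1)^-1 *: Tmx hq l (lo k).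
    by rewrite (Atilde_Tmx hq) (negPf (lnlo k)) sub0r scalerN scaleNr.
  split=> [i k|i k|i k]; rewrite !E; set c := - _^-1.
  + rewrite rmorphXn /= incl_K -!scalerAr -!scalerAl.
    have /qcomm_sqr -> := K_mul_Tmx hq (lo i) l (lo k).
    rewrite /weight (negPf (lnlo _)) (inj_eq (@lo_inj n)) subr0 (eq_sym k).
    by rewrite qhalf_sqr // !scalerA mulrC.
  + rewrite incl_e incl_KhV -root_pairing_lo -(inj_eq (@lo_inj n)) lo_hi.
    by rewrite -scalerAr e_mul_Tmx_row //; alg_field (R[i]).
  + rewrite incl_f incl_KhV -root_pairing_lo lo_hi -(inj_eq (@lo_inj n)).
    by rewrite -scalerAr f_mul_Tmx_row //; alg_field (R[i]).
Qed.
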